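(* Let $\Gamma\colon\mathbb{R}\to\mathbb{R}$ be a continuous function such that the limits $\gamma_\pm:=\lim_{t\to\pm\infty}\Gamma(t)$ exist and are finite, and let $p\colon\mathbb{R}\to\mathbb{R}$ be a BPUC function. Define $\lambda_*\colon(\mathbb{R}\cup\{\pm\infty\})\times[0,\infty)\to\mathbb{R}$ by $$\lambda_*(c,h):=\lambda^*\big(2\,\Gamma_c^h,\;p-(\Gamma_c^h)^2\big),$$ with $\Gamma_c^h$ as in the context. Then: (i) the map $\lambda_*$ is bounded: it takes values in $[-\|p\|,\|p\|+\|\Gamma\|^2]$. (ii) The map $\lambda_*$ is jointly continuous.
   Context: BPUC functions: a set $\Delta=\{a_j\mid j\in\mathbb{Z}\}\subset\mathbb{R}$ is disperse if $\inf_{j\in\mathbb{Z}}(a_{j+1}-a_j)>0$. $BPUC_\Delta(\mathbb{R},\mathbb{R})$ is the set of bounded right-continuous functions $q\colon\mathbb{R}\to\mathbb{R}$ such that for all $\varepsilon>0$ there is $\delta>0$ such that, if $t_1,t_2\in(a_j,a_{j+1})$ for some $j\in\mathbb{Z}$ and $|t_2-t_1|<\delta$, then $|q(t_2)-q(t_1)|<\varepsilon$. A function $q$ is BPUC if $q=q_1+\cdots+q_n$ with $q_i\in BPUC_{\Delta_i}(\mathbb{R},\mathbb{R})$ for finitely many disperse sets $\Delta_1,\dots,\Delta_n$. $\|q\|:=\sup_{t\in\mathbb{R}}|q(t)|$. Transition functions: let $\gamma_0:=\Gamma(0)$. For $c\in\mathbb{R}$: $\Gamma_c^0(t):=\Gamma(c\,t)$,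 and for $h>0$, $\Gamma_c^h(t):=\Gamma(c\,j\,h)$ if $t\in[jh,(j+1)h)$, $j\in\mathbb{Z}$. For $c=\infty$: $\Gamma_\infty^0(t):=\gamma_-$ if $t<0$ and $\gamma_+$ if $t\ge0$; for $h>0$, $\Gamma_\infty^h(t):=\gamma_-$ if $t<0$, $\gamma_0$ if $0\le t<h$, $\gamma_+$ if $t\ge h$. For $c=-\infty$: $\Gamma_{-\infty}^0(t):=\gamma_+$ if $t<0$ and $\gamma_-$ if $t\ge0$; for $h>0$, $\Gamma_{-\infty}^h(t):=\gamma_+$ if $t<0$, $\gamma_0$ if $0\le t<h$, $\gamma_-$ if $t\ge h$. All these functions are BPUC. Bifurcation value: for BPUC functions $q,p$, $\lambda^*(q,p)$ is the unique real number such that $x'=-x^2+q(t)x+p(t)+\lambda$ has a solution defined and bounded on $\mathbb{R}$ if and only if $\lambda\ge\lambda^*(q,p)$ (such a number exists). Thus $\lambda_*(c,h)$ is the corresponding value for $y'=-(y-\Gamma_c^h(t))^2+p(t)+\lambda$. Solutions are in the Carathéodory sense (absolutely continuous on compact intervals, satisfying the equation a.e.). $\mathbb{R}\cup\{\pm\infty\}$ is the extended real line with its usual (order) topology. *)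

(* Defs.v *)
From HB Require Import structures.
From mathcomp Require Import all_boot all_order all_algebra.
From mathcomp Require Import all_classical all_reals all_analysis.
Import Order.TTheory GRing.Theory Num.Theory.
Import numFieldNormedType.Exports.

Set Implicit Arguments.
Unset Strict Implicit.
Unset Printing Implicit Defensive.

Local Open Scope classical_set_scope.
Local Open Scope ring_scope.

Section BPUC.
Context {R : realType}.

Definition supnorm (q : R -> R) : R := sup (range (fun t => `|q t|)).

(* A disperse set is represented by its enumeration over the integers.  The
   real-valued [inf] is 0 on sets with no lower bound, so that [0 < inf _] does
   entail that the gaps are bounded away from 0. *)
Definition disperse (a : int -> R) : Prop :=
  0 < inf (range (fun j : int => a (j + 1) - a j)).

Definition BPUC_on (a : int -> R) (q : R -> R) : Prop :=
  [/\ bounded_fun q,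
      forall t, q s @[s --> t^'+] --> q t &
      forall e : R, 0 < e -> exists2 d : R, 0 < d &
        forall (j : int) (t1 t2 : R),
          a j < t1 < a (j + 1) -> a j < t2 < a (j + 1) ->
          `|t2 - t1| < d -> `|q t2 - q t1| < e].

Definition BPUC (q : R -> R) : Prop :=
  exists (n : nat) (a : 'I_n -> int -> R) (r : 'I_n -> R -> R),
    (forall i, disperse (a i) /\ BPUC_on (a i) (r i)) /\
    q = (fun t => \sum_(i < n) r i t).

End BPUC.

Section Caratheodory.
Context {R : realType}.

(* The total variation of [x] over finitely many non-overlapping subintervals
   ]l i, u i[ of [a, b] is small as soon as their total length is. *)
Definition abs_continuous_on (a b : R) (x : R -> R) : Prop :=
  forall e : R, 0 < e -> exists2 d : R, 0 < d &
    forall (n : nat) (l u : 'I_n -> R),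
      (forall i, [/\ a <= l i, l i <= u i & u i <= b]) ->
      trivIset [set: 'I_n] (fun i => `]l i, u i[%classic) ->
      \sum_(i < n) (u i - l i) < d ->
      \sum_(i < n) `|x (u i) - x (l i)| < e.

Definition caratheodory_solution (f : R -> R -> R) (x : R -> R) : Prop :=
  (forall a b : R, a <= b -> abs_continuous_on a b x) /\
  {ae lebesgue_measure, forall t : R, is_derive t (1 : R) x (f t (x t))}.

Definition has_bounded_solution (f : R -> R -> R) : Prop :=
  exists x : R -> R, caratheodory_solution f x /\ bounded_fun x.

End Caratheodory.

Section Bifurcation.
Context {R : realType}.

Definition riccati (q p : R -> R) (lambda t x : R) : R :=
  - x ^+ 2 + q t * x + p t + lambda.

Definition is_bifurcation_value (q p : R -> R) (l : R) : Prop :=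
  forall lambda : R, has_bounded_solution (riccati q p lambda) <-> l <= lambda.

(* Definite description: at most one real is a bifurcation value, and one
   exists whenever [q] and [p] are BPUC; the default 0 is then irrelevant. *)
Definition lambda_star (q p : R -> R) : R :=
  xget 0 [set l | is_bifurcation_value q p l].

End Bifurcation.

Section Transition.
Context {R : realType}.
Variables (Gamma : R -> R) (gm gp : R).

Definition transition0 (c : \bar R) (t : R) : R :=
  match c with
  | EFin r => Gamma (r * t)
  | +oo%E => if t < 0 then gm else gp
  | -oo%E => if t < 0 then gp else gm
  end.

(* For h > 0, the j with t in [j h, (j + 1) h[ is the floor of t / h. *)
Definition transition_pos (c : \bar R) (h t : R) : R :=
  match c with
  | EFin r => Gamma (r * (Num.floor (t / h))%:~R * h)
  | +oo%E => if t < 0 then gm else if t < h then Gamma 0 else gp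
  | -oo%E => if t < 0 then gp else if t < h then Gamma 0 else gm
  end.

(* Only meaningful for h >= 0. *)
Definition transition (c : \bar R) (h : R) : R -> R :=
  if h == 0 then transition0 c else transition_pos c h.

Definition lambda_transition (p : R -> R) (c : \bar R) (h : R) : R :=
  lambda_star (fun t => 2 * transition c h t)
              (fun t => p t - transition c h t ^+ 2).

End Transition.

(* Main.v *)
Require Import Defs.
From HB Require Import structures.
From mathcomp Require Import all_boot all_order all_algebra.
From mathcomp Require Import all_classical all_reals all_analysis.
From mathcomp Require Import measurable_realfun ring lra.
Set Implicit Arguments.
Unset Strict Implicit.
Unset Printing Implicit Defensive.
Import Order.TTheory GRing.Theory Num.Theory.
Import numFieldNormedType.Exports.
Local Open Scope classical_set_scope.
Local Open Scope ring_scope.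

(** Completing the square turns the equation into
      y' = - (y - g)^2 + p + lambda,
    where g is the transition function.  The argument works throughout with
    bounded subsolutions: locally absolutely continuous functions w with
    w' <= - (w - g)^2 + p + lambda almost everywhere.

    Two facts about them are needed.  First, absolute continuity upgrades
    almost everywhere differential inequalities to true ones
    ([ac_nonincreasing]); weighting by an exponential then bounds every bounded
    subsolution by a constant that depends only on bounds for g, p and lambda
    ([subsolution_apriori]), and shows that none exists below -|p|
    ([subsolution_lambda_ge]).  Second, a bounded subsolution forces a bounded
    solution ([bounded_subsolution_solution]): for a large rate L the map
      x |-> int_{-oo}^t e^{-L (t - s)} (f(s, x(s)) + L x(s)) ds
    is monotone on a ball, its fixed points are the bounded solutions, a
    subsolution lies below its own image, and so the iterates increase to a
    fixed point.  Hence the parameters that admit a bounded solution form an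
    up-set.  It is closed because the tail suprema of solutions for parameters
    decreasing to lambda are subsolutions of the fixed-point equation that
    decrease to one for lambda ([has_bounded_solution_closed]).  So the
    bifurcation value exists and is attained, and the constant subsolution 0
    supplies the upper bound of part (i).

    For part (ii), let y be a bounded solution for the coefficient g1 and D a
    bounded absolutely continuous function.  If
      D' + M |D - (g2 - g1)| <= e
    for a suitable constant M, then y + D is a subsolution for g2 at the
    parameter raised by e, so the bifurcation value rises by at most e
    ([bifurcation_value_perturbation]).  Two choices of D are used along a
    sequence (c_n, h_n) converging to (c, h).

    If c is not 0, the transition functions converge almost everywhere, and
    uniformly for large |t| since both are then close to the same limit of
    Gamma.  Dominated convergence makes the integral of |g2 - g1| small on any
    compact interval, and D = - M int |g2 - g1| over that interval absorbs it
    ([bifurcation_value_integral_close]).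

    If c = 0, convergence is only locally uniform, but the functions become
    slow: they vary little over bounded times.  Then D is an exponential moving
    average of g2 - g1, which follows its argument closely and has a small
    derivative ([bifurcation_value_slow_close]). *)

(** * Monotonicity of absolutely continuous functions *)

Section MonotoneAC.
Context {R : realType}.
Notation mu := (@lebesgue_measure R).
Implicit Types (x : R -> R) (U : set R) (a b e s t : R).

(** The growth of [x] on [a, t] is paid for by the slope [e] and by the
    variation of [x] over finitely many successive intervals inside [U].  In
    the application [U] is a small open set that contains every point at which
    the derivative is not under control. *)
Definition growth_within x U a e t : Prop :=
  exists (n : nat) (l u : nat -> R),
   [/\ forall i, (i < n)%N ->
         [/\ a <= l i, l i <= u i, u i <= t & `]l i, u i[ `<=` U],
       forall i j, (i < j)%N -> (j < n)%N -> u i <= l j &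
       x t - x a <= e * (t - a) + \sum_(i < n) `|x (u i) - x (l i)|].

Lemma growth_within_slope x U a e s t : s <= t ->
  x t - x s <= e * (t - s) -> growth_within x U a e s -> growth_within x U a e t.
Proof.
move=> st xst [n [l [u [H1 H2 H3]]]]; exists n, l, u; split => //.
  by move=> i /H1[al lu us lU]; split => //; exact: le_trans st.
by lra.
Qed.

Lemma growth_within_jump x U a e s t : 0 <= e -> a <= s -> s <= t ->
  `]s, t[ `<=` U -> growth_within x U a e s -> growth_within x U a e t.
Proof.
move=> e0 as_ st stU [n [l [u [H1 H2 H3]]]].
exists n.+1, (fun i => if i == n then s else l i),
  (fun i => if i == n then t else u i); split.
- move=> i; rewrite ltnS leq_eqVlt; case: eqP => [-> _|_ /=]; first by split.
  by move=> /H1[al lu us lU]; split => //; exact: le_trans st.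
- move=> i j ij; rewrite ltnS => jn.
  have ni : (i < n)%N by exact: leq_trans jn.
  rewrite (ltn_eqF ni); case: eqP => [_|/eqP jnn].
    by have [] := H1 _ ni.
  by apply: H2 => //; rewrite ltn_neqAle jnn.
- rewrite big_ord_recr /= eqxx.
  under eq_bigr => i _ do rewrite (ltn_eqF (ltn_ord i)).
  have := ler_norm (x t - x s); have : 0 <= e * (t - s) by rewrite mulr_ge0 ?subr_ge0.
  by lra.
Qed.

Lemma is_derive_slope x t d e : d <= 0 -> 0 < e -> is_derive t (1 : R) x d ->
  exists2 r, 0 < r & forall s, `|s - t| < r ->
    (s <= t -> x t - x s <= e * (t - s)) /\ (t <= s -> x s - x t <= e * (s - t)).
Proof.
move=> d0 e0 [dx dE].
move: dx; rewrite /derivable => /cvg_ex[d' cd'].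
have dd' : d' = d.
  rewrite -dE; apply/esym/cvg_lim => //.
rewrite {}dd' in cd'.
move/cvgrPdist_lt : cd' => /(_ e e0).
rewrite near_withinE => -[r /= r0 Hr]; exists r => // s str.
have K : s != t -> (s - t)^-1 * (x s - x t) <= e.
  move=> nst; have := Hr (s - t).
  rewrite /= sub0r normrN subr_eq0 => /(_ str nst).
  rewrite /GRing.scale /= mulr1 subrK => /ltr_normlP[+ _].
  by lra.
split; rewrite le_eqVlt => /predU1P[->|st].
- by rewrite !subrr mulr0.
- have /K : s != t by rewrite lt_eqF.
  have ts : 0 < t - s by rewrite subr_gt0.
  by rewrite -(opprB t s) invrN mulNr -mulrN opprB mulrC ler_pdivrMr.
- by rewrite !subrr mulr0.
- have /K : s != t by rewrite gt_eqF.
  by rewrite mulrC ler_pdivrMr // subr_gt0.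
Qed.

Lemma small_open_cover (P : R -> Prop) e : {ae mu, forall t, P t} -> 0 < e ->
  exists2 U : set R, open U /\ (mu U < e%:E)%E & forall t, ~ P t -> U t.
Proof.
move=> [A [mA A0 PA]] e0.
have [|U [oU AU UA]] := @lebesgue_regularity_outer R A e mA _ e0.
  by rewrite [X in (X < _)%E](_ : _ = 0%E).
exists U => [|t nPt]; last by apply: AU; apply: PA.
split=> //.
have mUA : measurable (U `\` A) by apply: measurableD => //; exact: open_measurable.
rewrite -(setDUK AU); apply: le_lt_trans UA.
apply: le_trans (measureU2 _ mA mUA) _.
by rewrite [X in (X + _)%E](_ : _ = 0%E) ?add0e.
Qed.

Lemma sum_itv_le (U : set R) (n : nat) (l u : nat -> R) e : open U ->
  (mu U < e%:E)%E ->
  (forall i, (i < n)%N -> l i <= u i /\ `]l i, u i[ `<=` U) ->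
  trivIset [set: 'I_n] (fun i : 'I_n => `]l i, u i[%classic) ->
  \sum_(i < n) (u i - l i) < e.
Proof.
move=> oU mU H1 tI; rewrite -lte_fin; apply: le_lt_trans mU.
rewrite -sumEFin.
rewrite (eq_bigr (fun i : 'I_n => mu `]l i, u i[%classic)); last first.
  move=> i _; rewrite lebesgue_measure_itv /= lte_fin.
  have [lu _] := H1 _ (ltn_ord i).
  case: ltgtP lu => [lu _|//|-> _]; first by rewrite EFinB.
  by rewrite subrr.
have mF (i : 'I_n) : measurable (`]l i, u i[%classic : set R) by [].
have mUF : measurable (\big[setU/set0]_(i < n) (`]l i, u i[%classic : set R)).
  by apply: bigsetU_measurable => i _; exact: mF.
have <- := measure_semi_additive_ord mu mF tI mUF.
apply: le_measure; rewrite ?inE //; first exact: open_measurable.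
apply: (big_ind (fun A : set R => A `<=` U)) => // [A B AU BU|i _].
  by rewrite subUset.
by have [] := H1 _ (ltn_ord i).
Qed.

(** Cover the exceptional null set by an open set [U] so small that the
    variation of [x] over disjoint intervals inside [U] is below [e].  Around
    every point, [growth_within] can be extended a little: by the sign of the
    derivative off the exceptional set, by adding one interval of [U] on it.
    The supremum of the reachable points is therefore [b], so
    [x b - x a <= e (b - a) + e]. *)
Lemma ac_nonincreasing x :
  (forall a b, a <= b -> abs_continuous_on a b x) ->
  {ae mu, forall t, exists2 d, d <= 0 & is_derive t (1 : R) x d} ->
  forall a b, a <= b -> x b <= x a.
Proof.
move=> acx dx a b ab; apply/ler_addgt0Pr => e0 e0_gt0.
pose e := e0 / (b - a + 1).
have ba0 : 0 < b - a + 1 by lra.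
have e_gt0 : 0 < e by rewrite divr_gt0.
have eE : e0 = e * (b - a) + e by rewrite /e; field; rewrite gt_eqF.
have [d d_gt0 acd] := acx _ _ ab _ e_gt0.
have [U [oU Ud] xU] := small_open_cover dx d_gt0.
have loc t : exists2 r, 0 < r & forall s, `|s - t| < r -> a <= s -> a <= t ->
   (s <= t -> growth_within x U a e s -> growth_within x U a e t) /\
   (t <= s -> growth_within x U a e t -> growth_within x U a e s).
  have [Ut|/xU Ut] := pselect (exists2 d, d <= 0 & is_derive t (1 : R) x d).
    have [c c0 /(is_derive_slope c0 e_gt0)[r r0 Hr]] := Ut.
    exists r => // s /Hr[H1 H2] _ _.
    by split=> st; apply: growth_within_slope => //; [exact: H1|exact: H2].
  have /nbhs_ballP[r /= r0 rU] := open_nbhs_nbhs (conj oU Ut).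
  exists r => // s sr as_ at_; split => st; apply: growth_within_jump => //.
  - exact: ltW.
  - move=> z /=; rewrite in_itv/= => /andP[z1 z2]; apply: rU; rewrite /ball/=.
    by rewrite gtr0_norm ?subr_gt0//; move: sr; rewrite distrC ger0_norm ?subr_ge0//; lra.
  - exact: ltW.
  - move=> z /=; rewrite in_itv/= => /andP[z1 z2]; apply: rU; rewrite /ball/=.
    by rewrite distrC gtr0_norm ?subr_gt0//; move: sr; rewrite ger0_norm ?subr_ge0//; lra.
(* The reachable points; [c] below is attained and cannot be less than [b]. *)
pose A := [set t | [/\ a <= t, t <= b & growth_within x U a e t]].
have Aa : A a.
  split=> //; exists 0%N, (fun=> 0), (fun=> 0); split => //.
  by rewrite big_ord0 !subrr mulr0 addr0.
have supA : has_sup A by split; [exists a|exists b => t []].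
pose c := sup A.
have ac : a <= c by apply: ub_le_sup => //; exact: supA.2.
have cb : c <= b by apply: ge_sup; [exists a|move=> t []].
have [r r0 Hr] := loc c.
have gc : growth_within x U a e c.
  have [t [at_ tb gt] crt] := sup_adherent r0 supA.
  have tc : t <= c by apply: ub_le_sup => //; exact: supA.2.
  apply: (proj1 (Hr t _ at_ ac)) => //.
  by rewrite distrC ger0_norm ?subr_ge0//; move: crt; rewrite -/c; lra.
have {r r0 Hr loc supA Aa} gb : growth_within x U a e b.
  have [->//|nbc] := eqVneq b c.
  have cb' : c < b by rewrite lt_neqAle eq_sym nbc.
  pose s := Num.min b (c + r / 2).
  have cs : c < s by rewrite /s lt_min cb' ltrDl divr_gt0.
  have sb : s <= b by rewrite /s ge_min lexx.
  have scr : s <= c + r / 2 by rewrite /s ge_min lexx orbT.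
  have As : A s.
    split=> //; first by lra.
    apply: (proj2 (Hr s _ _ ac)) => //; last 2 first.
    - by lra.
    - exact: ltW.
    - by rewrite gtr0_norm ?subr_gt0//; lra.
  have : s <= c by apply: ub_le_sup => //; exact: supA.2.
  by rewrite leNgt cs.
have [n [l [u [H1 H2 H3]]]] := gb.
have tI : trivIset [set: 'I_n] (fun i : 'I_n => `]l i, u i[%classic).
  have uv (i j : 'I_n) : (i < j)%N -> `]l i, u i[ `&` `]l j, u j[ = set0.
    move=> ij; apply/seteqP; split=> // z [] /=.
    rewrite !in_itv/= => /andP[_ zu] /andP[lz _].
    by have := H2 _ _ ij (ltn_ord j); rewrite leNgt (lt_trans lz zu).
  apply/trivIsetP => i j _ _; rewrite neq_ltn => /orP[/uv//|/uv].
  by rewrite setIC.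
have lenU : \sum_(i < n) (u i - l i) < d.
  by apply: (sum_itv_le oU Ud) tI => i /H1[].
have := acd n (fun i => l i) (fun i => u i) _ tI lenU.
have lub (i : 'I_n) : [/\ a <= l i, l i <= u i & u i <= b].
  by have [] := H1 _ (ltn_ord i).
move=> /(_ lub); rewrite eE; lra.
Qed.

End MonotoneAC.

(** * Calculus of locally absolutely continuous functions *)

Section AlmostEverywhere.
Context {R : realType}.
Notation mu := (@lebesgue_measure R).
Implicit Types P Q S : R -> Prop.

Lemma ae_imply P Q : (forall t, P t -> Q t) ->
  {ae mu, forall t, P t} -> {ae mu, forall t, Q t}.
Proof. by move=> PQ; apply: filterS => //; exact: (ae_filter_ringOfSetsType mu). Qed.

Lemma ae_imply2 P Q S : (forall t, P t -> Q t -> S t) ->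
  {ae mu, forall t, P t} -> {ae mu, forall t, Q t} -> {ae mu, forall t, S t}.
Proof. by move=> PQ; apply: filterS2 => //; exact: (ae_filter_ringOfSetsType mu). Qed.

End AlmostEverywhere.

Section AbsolutelyContinuous.
Context {R : realType}.
Notation mu := (@lebesgue_measure R).
Implicit Types (x y : R -> R) (a b e s t : R).

Definition locally_ac x : Prop := forall a b, a <= b -> abs_continuous_on a b x.

Lemma locally_ac_continuous x : locally_ac x -> continuous x.
Proof.
move=> acx t; apply/cvgrPdist_lt => e e0.
have t11 : t - 1 <= t + 1 by lra.
have [d d0 Hd] := acx _ _ t11 _ e0.
near=> s.
have : `|t - s| < Num.min 1 d.
  by near: s; apply: cvgr_dist_lt => //; rewrite lt_min ltr01.
rewrite lt_min => /andP[ts1 tsd].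
have tI (l u : R) : trivIset [set: 'I_1] (fun=> `]l, u[%classic).
  by apply/trivIsetP => i j _ _; rewrite !ord1 eqxx.
have [st|ts] := leP s t.
- have := Hd 1%N (fun=> s) (fun=> t) _ (tI _ _).
  rewrite !big_ord1; apply => [_|].
    by split=> //; move: ts1; rewrite ger0_norm ?subr_ge0//; lra.
  by move: tsd; rewrite ger0_norm ?subr_ge0.
- have := Hd 1%N (fun=> t) (fun=> s) _ (tI _ _).
  rewrite !big_ord1 distrC; apply => [_|].
    by split=> //; [|exact: ltW|]; move: ts1; rewrite ltr0_norm ?subr_lt0//; lra.
  by move: tsd; rewrite ltr0_norm ?subr_lt0// opprB.
Unshelve. all: by end_near. Qed.

Lemma continuous_bounded_itv x a b : continuous x -> a <= b ->
  exists2 M, 0 < M & forall t, a <= t <= b -> `|x t| <= M.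
Proof.
move=> cx ab.
have cN : {within `[a, b], continuous (fun t => `|x t|)}.
  apply: continuous_subspaceT => t; apply: continuous_comp; first exact: cx.
  exact: norm_continuous.
have [c _ Hc] := EVT_max ab cN.
exists (`|x c| + 1) => [|t tab]; first by rewrite ltr_wpDl.
by rewrite (le_trans (Hc t _)) ?in_itv// lerDl.
Qed.

Lemma locally_acD x y : locally_ac x -> locally_ac y ->
  locally_ac (fun t => x t + y t).
Proof.
move=> acx acy a b ab e e0; have e20 : 0 < e / 2 by rewrite divr_gt0.
have [d1 d10 H1] := acx _ _ ab _ e20.
have [d2 d20 H2] := acy _ _ ab _ e20.
exists (Num.min d1 d2) => [|n l u lu tI]; first by rewrite lt_min d10.
rewrite lt_min => /andP[/(H1 _ _ _ lu tI) h1 /(H2 _ _ _ lu tI) h2].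
apply: (@le_lt_trans _ _
  (\sum_(i < n) `|x (u i) - x (l i)| + \sum_(i < n) `|y (u i) - y (l i)|)).
  rewrite -big_split; apply: ler_sum => i _ /=.
  by rewrite opprD addrACA ler_normD.
by rewrite (splitr e) ltrD.
Qed.

Lemma locally_acM x y : locally_ac x -> locally_ac y ->
  locally_ac (fun t => x t * y t).
Proof.
move=> acx acy a b ab e e0.
have [M M0 HM] := continuous_bounded_itv (locally_ac_continuous acx) ab.
have [N N0 HN] := continuous_bounded_itv (locally_ac_continuous acy) ab.
have eN : 0 < e / 2 / N by rewrite !divr_gt0.
have eM : 0 < e / 2 / M by rewrite !divr_gt0.
have [d1 d10 H1] := acx _ _ ab _ eN.
have [d2 d20 H2] := acy _ _ ab _ eM.
exists (Num.min d1 d2) => [|n l u lu tI]; first by rewrite lt_min d10.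
rewrite lt_min => /andP[/(H1 _ _ _ lu tI) h1 /(H2 _ _ _ lu tI) h2].
apply: (@le_lt_trans _ _
  (N * (\sum_(i < n) `|x (u i) - x (l i)|) +
   M * (\sum_(i < n) `|y (u i) - y (l i)|))).
  rewrite !mulr_sumr -big_split; apply: ler_sum => i _ /=.
  have [al lui ub] := lu i.
  have -> : x (u i) * y (u i) - x (l i) * y (l i) =
    y (u i) * (x (u i) - x (l i)) + x (l i) * (y (u i) - y (l i)) by ring.
  rewrite (le_trans (ler_normD _ _))// !normrM lerD// ler_wpM2r//.
    by rewrite HN// ub (le_trans al).
  by rewrite HM// al (le_trans lui).
rewrite (splitr e) ltrD// mulrC; rewrite -ltr_pdivlMr//.
Qed.

Lemma locally_lipschitz_ac x :
  (forall a b, a <= b -> exists2 C, 0 <= C &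
     forall s t, a <= s -> s <= t -> t <= b -> `|x t - x s| <= C * (t - s)) ->
  locally_ac x.
Proof.
move=> lx a b ab e e0; have [C C0 HC] := lx _ _ ab.
have C1 : 0 < C + 1 by rewrite ltr_wpDl.
exists (e / (C + 1)) => [|n l u lu tI]; first by rewrite divr_gt0.
rewrite ltr_pdivlMr// => H; apply: le_lt_trans H.
rewrite mulr_suml; apply: ler_sum => i _.
have [al lui ub] := lu i.
rewrite (le_trans (HC _ _ al lui ub))// mulrC ler_wpM2l ?subr_ge0//.
by rewrite lerDl.
Qed.

Lemma locally_ac_cst k : locally_ac (fun=> k).
Proof.
apply: locally_lipschitz_ac => a b _; exists 0 => // s t _ _ _.
by rewrite subrr normr0 mul0r.
Qed.

Lemma locally_acB x y : locally_ac x -> locally_ac y ->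
  locally_ac (fun t => x t - y t).
Proof.
move=> acx acy; have -> : (fun t => x t - y t) = (fun t => x t + (-1) * y t).
  by apply/funext => t; rewrite mulN1r.
by apply: locally_acD => //; apply: locally_acM => //; exact: locally_ac_cst.
Qed.

(** The tangent inequality 1 + z <= exp z at z = v - u, multiplied by
    exp u; it is the local Lipschitz estimate for the exponential. *)
Lemma expR_sub_le (u v : R) : expR u - expR v <= expR u * (u - v).
Proof.
have := expR_ge1Dx (v - u); rewrite -(ler_pM2l (expR_gt0 u)) -expRD.
rewrite (_ : u + (v - u) = v); last by ring.
by lra.
Qed.

Lemma locally_ac_expR k : locally_ac (fun t => expR (k * t)).
Proof.
apply: locally_lipschitz_ac => a b ab.
pose E := expR (k * a) + expR (k * b).
have E0 : 0 <= E by rewrite addr_ge0// expR_ge0.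
exists (E * `|k|) => [|s t as_ st tb]; first by rewrite mulr_ge0.
have bnd r : a <= r -> r <= b -> expR (k * r) <= E.
  move=> ar rb; have [k0|k0] := leP 0 k.
    by rewrite ler_wpDl ?expR_ge0// ler_expR ler_wpM2l.
  by rewrite ler_wpDr ?expR_ge0// ler_expR ler_wnM2l// ltW.
have key r r' : a <= r -> r <= b -> expR (k * r) - expR (k * r') <= E * (`|k| * `|r - r'|).
  move=> ar rb; rewrite (le_trans (expR_sub_le _ _))// -mulrBr.
  apply: (@le_trans _ _ (expR (k * r) * (`|k| * `|r - r'|))).
    by rewrite ler_wpM2l ?expR_ge0// -normrM ler_norm.
  by rewrite ler_wpM2r ?mulr_ge0// bnd.
have ts0 : `|t - s| = t - s by rewrite ger0_norm ?subr_ge0.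
rewrite ler_norml -mulrA -ts0 key ?(le_trans as_)// andbT.
by rewrite lerNl opprB distrC key// (le_trans st).
Qed.

Lemma is_derive_expR_linear (k t : R) :
  is_derive t (1 : R) (fun s => expR (k * s)) (k * expR (k * t)).
Proof.
have H : is_derive t (1 : R) (fun s => k * s) k.
  have -> : (fun s : R => k * s) = k \*: (@id R) by [].
  by apply: is_derive_eq; rewrite /GRing.scale /= mulr1.
rewrite mulrC; exact: (is_derive1_comp (is_derive_expR _) H).
Qed.

End AbsolutelyContinuous.

(** * Primitives of exponentially bounded functions *)

Section Primitive.
Context {R : realType}.
Notation mu := (@lebesgue_measure R).
Implicit Types (f g : R -> R) (s t : R).

Definition primitive f t : R := \int[mu]_(s in `]-oo, t]) f s.

(** An exponential bound makes [f] integrable on every half-line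
    ]-oo, t], which is what lets one global primitive serve the whole line. *)
Definition exp_bounded (k C : R) f : Prop :=
  measurable_fun setT f /\ forall s, `|f s| <= C * expR (k * s).

Section fixed_rate.
Variable k : R.
Hypothesis k0 : 0 < k.

Lemma continuous_expR_linear (r : R) : continuous (fun s : R => expR (r * s)).
Proof. exact: locally_ac_continuous (locally_ac_expR r). Qed.

Lemma integral_expR_Ny t :
  (\int[mu]_(s in `]-oo, t]) (expR (k * s))%:E = (expR (k * t) / k)%:E)%E.
Proof.
rewrite -{1}(opprK t) ge0_integration_by_substitutionNy; last 2 first.
- by apply: continuous_subspaceT; exact: continuous_expR_linear.
- by move=> s _; rewrite expR_ge0.
have dF s : is_derive s (1 : R) (fun r => - (expR (- k * r) / k)) (expR (k * - s)).
  have H := is_derive_expR_linear (- k) s.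
  have -> : (fun r : R => - (expR (- k * r) / k)) =
            (- k^-1) \*: (fun r : R => expR (- k * r)).
    by apply/funext => r; rewrite /GRing.scale /= [RHS]mulNr [in RHS]mulrC.
  apply: is_derive_eq; rewrite /GRing.scale /= mulrA mulrNN mulVf ?gt_eqF//.
  by rewrite mul1r mulrN mulNr.
rewrite (@ge0_continuous_FTC2y _ _ (fun r => - (expR (- k * r) / k)) _ 0)//.
- by rewrite sub0e -EFinN opprK mulrNN.
- by move=> s _; rewrite expR_ge0.
- apply: continuous_subspaceT => s /=.
  apply: (@continuous_comp _ _ _ (-%R) (fun r => expR (k * r))).
    exact: oppr_continuous.
  exact: continuous_expR_linear.
- rewrite -oppr0 -(mul0r k^-1); apply: cvgN; apply: cvgMl.
  rewrite (_ : (fun x => expR (- k * x)) =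
               (fun z => expR (- z)) \o (fun z => k * z)); last first.
    by apply/funext => x; rewrite /= mulNr.
  apply: (@cvg_comp _ _ _ _ _ _ (pinfty_nbhs R)); last exact: cvgr_expR.
  exact: gt0_cvgMry.
- apply: cvgN; apply: cvgMl; apply/cvg_at_right_filter.
  have := @continuous_expR_linear (- k) (- t).
  exact.
- by move=> s _; rewrite derive1E; exact: (@derive_val _ _ _ _ _ _ _ (dF s)).
Qed.

Lemma exp_integrable C t : mu.-integrable `]-oo, t] (EFin \o (fun s => C * expR (k * s))).
Proof.
apply: (@eq_integrable _ _ _ mu _ _ (fun s => C%:E * (expR (k * s))%:E)%E) => //.
apply: integrableZl => //; apply/integrableP; split.
  apply/measurable_EFinP; apply: measurable_funTS.
  by apply: continuous_measurable_fun; exact: continuous_expR_linear.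
under eq_integral do rewrite /= ger0_norm ?expR_ge0//.
by rewrite integral_expR_Ny ltry.
Qed.

Lemma primitive_expR C t :
  primitive (fun s => C * expR (k * s)) t = C * (expR (k * t) / k).
Proof.
rewrite /primitive RintegralZl//.
  by rewrite /Rintegral integral_expR_Ny.
by have := exp_integrable 1 t; apply: eq_integrable => // s _; rewrite /= mul1r.
Qed.

Lemma exp_bounded_integrable C f t : exp_bounded k C f ->
  mu.-integrable `]-oo, t] (EFin \o f).
Proof.
move=> [mf fC]; apply: le_integrable (exp_integrable C t) => //.
  by apply/measurable_EFinP; exact: measurable_funTS.
move=> s _; rewrite /= lee_fin (le_trans (fC s))// ler_norm//.
Qed.

Lemma le_primitive C C' f g t : exp_bounded k C f -> exp_bounded k C' g ->
  (forall s, s <= t -> f s <= g s) -> primitive f t <= primitive g t.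
Proof.
move=> bf bg fg; apply: le_Rintegral => //.
- exact: exp_bounded_integrable bf.
- exact: exp_bounded_integrable bg.
Qed.

Lemma exp_bounded_expR C : 0 <= C -> exp_bounded k C (fun s => C * expR (k * s)).
Proof.
move=> C0; split=> [|s]; last by rewrite ger0_norm ?mulr_ge0 ?expR_ge0.
apply: measurable_funM => //.
by apply: continuous_measurable_fun; exact: continuous_expR_linear.
Qed.

Lemma exp_bounded_ge0 C f : exp_bounded k C f -> 0 <= C.
Proof.
by move=> [_ /(_ 0)]; rewrite mulr0 expR0 mulr1; apply: le_trans.
Qed.

Lemma exp_boundedN C f : exp_bounded k C f -> exp_bounded k C (fun s => - f s).
Proof.
by move=> [mf fC]; split=> [|s]; [exact: measurableT_comp|rewrite normrN].
Qed.

Lemma primitiveN C f t : exp_bounded k C f ->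
  primitive (fun s => - f s) t = - primitive f t.
Proof.
move=> bf; rewrite -[RHS]mulN1r -RintegralZl//; last first.
  exact: exp_bounded_integrable bf.
by apply: eq_Rintegral => s _; rewrite mulN1r.
Qed.

Lemma normr_primitive_le C f t : exp_bounded k C f ->
  `|primitive f t| <= C * (expR (k * t) / k).
Proof.
move=> bf; have C0 := exp_bounded_ge0 bf.
have bE := exp_bounded_expR C0.
rewrite ler_norml -primitive_expR -(primitiveN _ bE); apply/andP; split.
  apply: (le_primitive (exp_boundedN bE) bf) => s _.
  by rewrite lerNl; have := bf.2 s => /ler_normlP[].
apply: (le_primitive bf bE) => s _.
by have := bf.2 s => /ler_normlP[].
Qed.

Lemma primitive_lipschitz C f s t : exp_bounded k C f -> s <= t ->
  `|primitive f t - primitive f s| <= C * (expR (k * t) / k - expR (k * s) / k).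
Proof.
move=> bf st; have C0 := exp_bounded_ge0 bf.
have bE := exp_bounded_expR C0.
have dE (h : R -> R) D : exp_bounded k D h ->
    primitive h t - primitive h s = \int[mu]_(r in `]s, t]) h r.
  move=> bh; apply: Rintegral_itvB; rewrite ?bnd_simp//.
  exact: exp_bounded_integrable bh.
have ii (h : R -> R) D : exp_bounded k D h -> mu.-integrable `]s, t] (EFin \o h).
  move=> bh; apply: integrableS (exp_bounded_integrable t bh) => //.
  exact: subset_itvr.
rewrite mulrBr -!primitive_expR (dE _ _ bf) (dE _ _ bE).
apply: le_trans (le_normr_Rintegral _ (ii _ _ bf)) _ => //.
apply: le_Rintegral => //.
- have : exp_bounded k C (fun r => `|f r|).
    split=> [|r]; last by rewrite normr_id; exact: bf.2.
    by apply: measurableT_comp => //; exact: bf.1.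
  exact: ii.
- exact: ii bE.
- by move=> r _; exact: bf.2.
Qed.

Lemma locally_ac_primitive C f : exp_bounded k C f -> locally_ac (primitive f).
Proof.
move=> bf; have C0 := exp_bounded_ge0 bf.
apply: locally_lipschitz_ac => a b ab.
exists (C * expR (k * b)) => [|s t as_ st tb]; first by rewrite mulr_ge0 ?expR_ge0.
rewrite (le_trans (primitive_lipschitz bf st))// -mulrA ler_wpM2l//.
rewrite -mulrBl ler_pdivrMr// (le_trans (expR_sub_le _ _))// -mulrA -mulrBr.
rewrite (mulrC (t - s)) ler_wpM2r//; last by rewrite ler_expR ler_pM2l.
by rewrite mulr_ge0 ?subr_ge0// ltW.
Qed.

Lemma is_derive_primitive_ae C f : exp_bounded k C f ->
  {ae mu, forall t, is_derive t (1 : R) (primitive f) (f t)}.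
Proof.
move=> bf; have C0 := exp_bounded_ge0 bf.
have lf : locally_integrable setT f.
  split; [exact: bf.1|exact: openT|move=> K _ cK].
  have [M [_ HM]] := compact_bounded cK.
  have KT : K `<=` `]-oo, (M + 1)].
    move=> s /(HM (M + 1)); rewrite ltrDl ltr01 => /(_ isT) /= sM.
    by rewrite in_itv/= (le_trans (ler_norm _)).
  have mK : measurable K by apply: closed_measurable; exact: compact_closed.
  have /integrableP[_ //] : mu.-integrable K (EFin \o f).
  by apply: integrableS (exp_bounded_integrable (M + 1) bf).
have := FTC1Ny (fun y => exp_bounded_integrable y bf) lf.
apply: ae_imply => t [dt tE]; split; first exact: dt.
by rewrite -derive1E.
Qed.

Lemma primitive_cvg C (f_ : nat -> R -> R) f t :
  (forall n, exp_bounded k C (f_ n)) ->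
  (forall s, f_ n s @[n --> \oo] --> f s) ->
  primitive (f_ n) t @[n --> \oo] --> primitive f t.
Proof.
move=> bf ff.
have := @dominated_cvg _ _ _ mu `]-oo, t]%classic (measurable_itv _)
  (fun n => EFin \o f_ n) (EFin \o f) (EFin \o (fun s => C * expR (k * s))).
move=> /(_ _ _ _ (exp_integrable C t) _) H.
have : (\int[mu]_(s in `]-oo, t]) (f_ n s)%:E @[n --> \oo] -->
        \int[mu]_(s in `]-oo, t]) (f s)%:E)%E.
  apply: H => //.
  - move=> n; apply/measurable_EFinP; apply: measurable_funTS; exact: (bf n).1.
  - by move=> s _; apply: cvg_EFin; [exact: nearW|exact: ff].
  - by move=> n s _; rewrite /= lee_fin; exact: (bf n).2.
have bl : exp_bounded k C f.
  split; first by apply: (@measurable_fun_cvg _ _ _ _ f_) => // n; exact: (bf n).1.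
  move=> s; have cN : `|f_ n s| @[n --> \oo] --> `|f s| by exact: cvg_norm.
  rewrite -(cvg_lim (@Rhausdorff R) cN); apply: limr_le.
    by apply/cvg_ex; exists `|f s|.
  by apply: nearW => n; exact: (bf n).2.
move=> K; apply: fine_cvg.
by rewrite fineK//; apply: integrable_fin_num => //; exact: exp_bounded_integrable bl.
Qed.

End fixed_rate.
End Primitive.

(** * Exponentially weighted differential inequalities *)

Section DifferentialInequality.
Context {R : realType}.
Notation mu := (@lebesgue_measure R).
Implicit Types (x y z : R -> R) (a b c s t : R).

Lemma is_derive_addR x y t dx dy : is_derive t (1 : R) x dx ->
  is_derive t (1 : R) y dy -> is_derive t (1 : R) (fun s => x s + y s) (dx + dy).
Proof. exact: is_deriveD. Qed.

Lemma is_derive_subR x y t dx dy : is_derive t (1 : R) x dx ->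
  is_derive t (1 : R) y dy -> is_derive t (1 : R) (fun s => x s - y s) (dx - dy).
Proof. exact: is_deriveB. Qed.

Lemma is_derive_mulR x y t dx dy : is_derive t (1 : R) x dx ->
  is_derive t (1 : R) y dy ->
  is_derive t (1 : R) (fun s => x s * y s) (dx * y t + x t * dy).
Proof.
move=> hx hy; have H := is_deriveM hx hy.
by apply: is_derive_eq; rewrite /GRing.scale /= addrC [y t * _]mulrC.
Qed.

(** The derivative of the weighted function is
    exp(- c t) (z' - c z) <= 0. *)
Lemma ac_exp_nonincreasing c z : locally_ac z ->
  {ae mu, forall t, exists2 d, d <= c * z t & is_derive t (1 : R) z d} ->
  forall a b, a <= b -> expR (- c * b) * z b <= expR (- c * a) * z a.
Proof.
move=> acz dz; apply: (ac_nonincreasing (x := fun t => expR (- c * t) * z t)).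
  exact: locally_acM (locally_ac_expR _) acz.
apply: ae_imply dz => t [d dle hd].
have H := is_derive_mulR (is_derive_expR_linear (- c) t) hd.
exists (- c * expR (- c * t) * z t + expR (- c * t) * d) => //.
rewrite (_ : _ + _ = expR (- c * t) * (d - c * z t)); last by ring.
by rewrite pmulr_rle0 ?expR_gt0// subr_le0.
Qed.

Lemma le0_of_le_expR (L C x0 a : R) : 0 < L ->
  (forall b, a <= b -> x0 <= C * expR (- L * b)) -> x0 <= 0.
Proof.
move=> L0 H; rewrite leNgt; apply/negP => x00.
(* At this point exp(L b) > L b >= C / x0, which contradicts the bound. *)
pose b := Num.max a (C / x0 / L).
have ab : a <= b by rewrite le_max lexx.
have CbL : C / x0 <= L * b.
  by rewrite [leRHS]mulrC -ler_pdivrMr// le_max lexx orbT.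
have := H _ ab; rewrite mulNr expRN ler_pdivlMr ?expR_gt0// leNgt => /negP; apply.
rewrite [ltRHS]mulrC -ltr_pdivrMr//; apply: le_lt_trans CbL _.
by apply: lt_le_trans (expR_ge1Dx _); rewrite ltrDr.
Qed.

(** The function exp(- L t) z(t) is nonincreasing and tends to 0 at +oo
    because [z] is bounded, hence it is nonnegative. *)
Lemma bounded_growth_ge0 L B z : 0 < L -> locally_ac z -> (forall t, `|z t| <= B) ->
  {ae mu, forall t, exists2 d, d <= L * z t & is_derive t (1 : R) z d} ->
  forall t, 0 <= z t.
Proof.
move=> L0 acz zB dz t.
have : - (expR (- L * t) * z t) <= 0.
  apply: (@le0_of_le_expR L B _ t L0) => b tb.
  have := ac_exp_nonincreasing acz dz tb.
  have : `|expR (- L * b) * z b| <= B * expR (- L * b).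
    by rewrite normrM ger0_norm ?expR_ge0// mulrC ler_wpM2r ?expR_ge0.
  by rewrite ler_norml => /andP[]; lra.
by rewrite oppr_le0 pmulr_rge0// expR_gt0.
Qed.

(** The function exp(L t) z(t) is nonincreasing and tends to 0 at -oo
    because [z] is bounded, hence it is nonpositive. *)
Lemma bounded_decay_le0 L B z : 0 < L -> locally_ac z -> (forall t, `|z t| <= B) ->
  {ae mu, forall t, exists2 d, d <= - L * z t & is_derive t (1 : R) z d} ->
  forall t, z t <= 0.
Proof.
move=> L0 acz zB dz t.
have : expR (L * t) * z t <= 0.
  apply: (@le0_of_le_expR L B _ (- t) L0) => b tb.
  have bt : - b <= t by rewrite lerNl.
  have := ac_exp_nonincreasing acz dz bt; rewrite opprK => K.
  have : `|expR (L * - b) * z (- b)| <= B * expR (L * - b).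
    by rewrite normrM ger0_norm ?expR_ge0// mulrC ler_wpM2r ?expR_ge0.
  by rewrite mulNr -mulrN ler_norml => /andP[]; lra.
by rewrite pmulr_rle0// expR_gt0.
Qed.

End DifferentialInequality.

(** * A priori bounds for bounded subsolutions *)

Section Riccati.
Context {R : realType}.
Notation mu := (@lebesgue_measure R).

Definition shifted_riccati (g p : R -> R) (lambda t x : R) : R :=
  - (x - g t) ^+ 2 + p t + lambda.

Lemma riccati_shift g p lambda :
  riccati (fun t => 2 * g t) (fun t => p t - g t ^+ 2) lambda =
  shifted_riccati g p lambda.
Proof.
by apply/funext => t; apply/funext => x; rewrite /riccati /shifted_riccati; ring.
Qed.

Definition subsolution (f : R -> R -> R) (w : R -> R) : Prop :=
  locally_ac w /\
  {ae mu, forall t, exists2 d, d <= f t (w t) & is_derive t (1 : R) w d}.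

Lemma caratheodory_subsolution f x : caratheodory_solution f x -> subsolution f x.
Proof. by move=> [acx dx]; split=> //; apply: ae_imply dx => t; exists (f t (x t)). Qed.

Variables (g p : R -> R) (G P lambda : R).
Hypotheses (gG : forall t, `|g t| <= G) (pP : forall t, `|p t| <= P).
Local Notation f := (shifted_riccati g p lambda).

(** Chosen so that the right-hand side is at most -1 at every state of
    this size or larger: with a = P + |lambda| the distance to [g] is then at
    least a + 1, and a - (a + 1)^2 <= -1. *)
Definition apriori_bound : R := G + P + `|lambda| + 1.
Local Notation K := apriori_bound.

Lemma shifted_riccati_lipschitz B t x y : `|x| <= B -> `|y| <= B ->
  `|f t x - f t y| <= 2 * (B + G) * `|x - y|.
Proof.
move=> xB yB; rewrite /shifted_riccati.
rewrite (_ : _ - _ = (2 * g t - x - y) * (x - y)); last by ring.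
rewrite normrM ler_wpM2r//; have := gG t.
rewrite !ler_norml in xB yB * => gB.
by apply/andP; split; lra.
Qed.

Lemma shifted_riccati_le t x : f t x <= P + lambda.
Proof.
rewrite /shifted_riccati; have := pP t; have := sqr_ge0 (x - g t).
by move=> + /ler_normlP[]; lra.
Qed.

Lemma shifted_riccati_lt_m1 t x : K <= `|x| -> f t x <= - 1.
Proof.
rewrite /shifted_riccati /apriori_bound => Kx.
have a0 : 0 <= P + `|lambda| by rewrite addr_ge0// (le_trans _ (pP 0)).
have : P + `|lambda| + 1 <= `|x - g t|.
  rewrite (le_trans _ (lerB_dist _ _))//.
  by have := gG t; lra.
set a := P + _ in a0 * => ax.
have : (a + 1) ^+ 2 <= (x - g t) ^+ 2.
  by rewrite -(real_normK (num_real (x - g t))) lerXn2r ?nnegrE// addr_ge0.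
have := pP t; move=> /ler_normlP[_]; have := ler_norm lambda.
have : a + 1 <= (a + 1) ^+ 2 by have : 0 <= a * (a + 1) by [rewrite mulr_ge0// addr_ge0]; rewrite expr2; lra.
by rewrite /a; lra.
Qed.

Lemma apriori_bound_gt0 : 0 < K.
Proof.
have G0 : 0 <= G by rewrite (le_trans _ (gG 0)).
have P0 : 0 <= P by rewrite (le_trans _ (pP 0)).
by rewrite /apriori_bound ltr_wpDl// !addr_ge0.
Qed.

Section bounded_subsolution.
Variables (w : R -> R) (B : R).
Hypotheses (subw : subsolution f w) (wB : forall t, `|w t| <= B).

Let L := 2 * (B + G) + 1.

Let L0 : 0 < L.
Proof. by have := gG 0; have := wB 0; have := normr_ge0 (g 0); have := normr_ge0 (w 0); rewrite /L; lra. Qed.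

Let slope t m : `|m| <= B -> f t (w t) <= f t m + L * `|w t - m|.
Proof.
move=> mB; have := shifted_riccati_lipschitz t (wB t) mB.
have := normr_ge0 (w t - m); rewrite /L => ? /ler_normlP[]; lra.
Qed.

(** A strict inequality at a lower bound [m] improves that bound: with
    z = w - m - e / L one has z' <= - e + L (w - m) = L z. *)
Lemma subsolution_inf_bound m e : `|m| <= B -> (forall t, m <= w t) ->
  (forall t, f t m <= - e) -> forall t, m + e / L <= w t.
Proof.
move=> mB mw fm t.
suff : 0 <= w t - (m + e / L) by rewrite subr_ge0.
apply: (@bounded_growth_ge0 _ L (B + `|m + e / L|) (fun t => w t - (m + e / L))).
- exact: L0.
- exact: locally_acB subw.1 (locally_ac_cst _).
- by move=> s; rewrite (le_trans (ler_normB _ _))// lerD2r.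
- apply: ae_imply subw.2 => s [d dle hd].
  exists d.
    rewrite mulrBr mulrDr mulrCA divff ?gt_eqF// mulr1.
    have := slope s mB; rewrite ger0_norm ?subr_ge0//; have := fm s; lra.
  have := is_derive_subR hd (is_derive_cst (m + e / L) s (1 : R)).
  by rewrite subr0.
Qed.

(** The mirror image of [subsolution_inf_bound]: with z = w - m + e / L
    one has z' <= - e + L (m - w) = - L z. *)
Lemma subsolution_sup_bound m e : `|m| <= B -> (forall t, w t <= m) ->
  (forall t, f t m <= - e) -> forall t, w t <= m - e / L.
Proof.
move=> mB mw fm t.
suff : w t - (m - e / L) <= 0 by rewrite subr_le0.
apply: (@bounded_decay_le0 _ L (B + `|m - e / L|) (fun t => w t - (m - e / L))).
- exact: L0.
- exact: locally_acB subw.1 (locally_ac_cst _).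
- by move=> s; rewrite (le_trans (ler_normB _ _))// lerD2r.
- apply: ae_imply subw.2 => s [d dle hd].
  exists d.
    rewrite mulNr !mulrBr mulrCA divff ?gt_eqF// mulr1.
    have := slope s mB; rewrite ler0_norm ?subr_le0//; have := fm s; lra.
  have := is_derive_subR hd (is_derive_cst (m - e / L) s (1 : R)).
  by rewrite subr0.
Qed.

Let m := inf (range w).
Let M := sup (range w).

Let has_inf_w : has_inf (range w).
Proof.
split; first by exists (w 0), 0.
by exists (- B) => _ [t _ <-]; have := wB t; rewrite ler_norml => /andP[].
Qed.

Let has_sup_w : has_sup (range w).
Proof.
split; first by exists (w 0), 0.
by exists B => _ [t _ <-]; have := wB t; rewrite ler_norml => /andP[].
Qed.

Let m_le t : m <= w t. Proof. by apply: ge_inf; [exact: has_inf_w.2|exists t]. Qed.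
Let le_M t : w t <= M. Proof. by apply: ub_le_sup; [exact: has_sup_w.2|exists t]. Qed.

Let mB : `|m| <= B.
Proof.
rewrite ler_norml; apply/andP; split.
  apply: lb_le_inf; first exact: has_inf_w.1.
  by move=> _ [t _ <-]; have := wB t; rewrite ler_norml => /andP[].
by rewrite (le_trans (m_le 0))//; have := wB 0; rewrite ler_norml => /andP[].
Qed.

Let MB : `|M| <= B.
Proof.
rewrite ler_norml; apply/andP; split; last first.
  apply: ge_sup; first exact: has_sup_w.1.
  by move=> _ [t _ <-]; have := wB t; rewrite ler_norml => /andP[].
by rewrite (le_trans _ (le_M 0))//; have := wB 0; rewrite ler_norml => /andP[].
Qed.

(** If lambda < -P, the right-hand side is at most P + lambda < 0 at every
    state, in particular at the infimum of [w], which could then be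
    improved. *)
Lemma subsolution_lambda_ge : - P <= lambda.
Proof.
rewrite leNgt; apply/negP => lP; pose e := - P - lambda.
have e0 : 0 < e by rewrite /e; lra.
have H : forall t, m + e / L <= w t.
  apply: subsolution_inf_bound => // t; rewrite /e opprB opprK addrC.
  exact: shifted_riccati_le.
have : m + e / L <= m.
  by apply: lb_le_inf; [exact: has_inf_w.1|move=> _ [t _ <-]].
by rewrite leNgt ltrDl divr_gt0.
Qed.

(** Outside the ball the right-hand side is at most -1, so the infimum or
    the supremum of [w] could be improved if it lay there. *)
Lemma subsolution_apriori t : `|w t| <= K.
Proof.
rewrite ler_norml; apply/andP; split; rewrite leNgt; apply/negP => wK.
  have Km : K <= `|m|.
    by rewrite -normrN (le_trans _ (ler_norm _))// lerNr ltW// (le_lt_trans (m_le t)).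
  have H : forall t, m + 1 / L <= w t.
    by apply: subsolution_inf_bound => // s; exact: shifted_riccati_lt_m1.
  have : m + 1 / L <= m.
    by apply: lb_le_inf; [exact: has_inf_w.1|move=> _ [s _ <-]].
  by rewrite leNgt ltrDl divr_gt0.
have KM : K <= `|M|.
  by rewrite (le_trans _ (ler_norm _))// ltW// (lt_le_trans wK).
have H : forall t, w t <= M - 1 / L.
  by apply: subsolution_sup_bound => // s; exact: shifted_riccati_lt_m1.
have : M <= M - 1 / L.
  by apply: ge_sup; [exact: has_sup_w.1|move=> _ [s _ <-]].
by rewrite leNgt gtrDl oppr_lt0 divr_gt0.
Qed.

End bounded_subsolution.
End Riccati.

(** * The fixed-point equation and monotone iteration *)

Section MildSolutions.
Context {R : realType}.
Notation mu := (@lebesgue_measure R).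
Variables (g p : R -> R) (G P K L Lam : R).
Hypotheses (mg : measurable_fun setT g) (mp : measurable_fun setT p).
Hypotheses (gG : forall t, `|g t| <= G) (pP : forall t, `|p t| <= P).
Hypotheses (K0 : 0 <= K) (L0 : 0 < L) (KL : 2 * (K + G) <= L).
Implicit Types (lambda s t : R) (x y w : R -> R).
Local Notation f := (shifted_riccati g p).

Definition in_ball x : Prop := measurable_fun setT x /\ forall t, `|x t| <= K.

Lemma in_ball_ge x t : in_ball x -> - K <= x t.
Proof. by move=> [_ /(_ t)]; rewrite ler_norml => /andP[]. Qed.

Lemma in_ball_le x t : in_ball x -> x t <= K.
Proof. by move=> [_ /(_ t)]; apply: le_trans; exact: ler_norm. Qed.

Definition mild_integrand lambda x s : R :=
  expR (L * s) * (f lambda s (x s) + L * x s).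

(** Variation of constants for x' + L x = f(t, x) + L x: the unique
    bounded solution of y' + L y = f(t, x(t)) + L x(t) is [mild_map lambda x].
    The exponential weight is kept under the primitive so that
    [is_derive_primitive_ae] applies. *)
Definition mild_map lambda x t : R :=
  expR (- L * t) * primitive (mild_integrand lambda x) t.

Local Notation C := ((K + G) ^+ 2 + P + Lam + L * K).

Lemma mild_integrand_bounded lambda x : `|lambda| <= Lam -> in_ball x ->
  exp_bounded L C (mild_integrand lambda x).
Proof.
move=> lamL [mx xK]; split.
  apply: measurable_funM.
    by apply: continuous_measurable_fun; exact: continuous_expR_linear.
  apply: measurable_funD; last by apply: measurable_funM.
  apply: measurable_funD => //; apply: measurable_funD => //.
  apply: measurableT_comp => //; apply: measurable_funX.
  by apply: measurable_funB.
move=> s; rewrite /mild_integrand normrM ger0_norm ?expR_ge0// mulrC.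
rewrite ler_wpM2r ?expR_ge0// (le_trans (ler_normD _ _))// lerD//; last first.
  by rewrite normrM gtr0_norm// ler_pM2l.
rewrite /shifted_riccati (le_trans (ler_normD _ _))// lerD//.
rewrite (le_trans (ler_normD _ _))// lerD// normrN normrX.
rewrite lerXn2r ?nnegrE// ?addr_ge0// ?(le_trans _ (gG 0))//.
by rewrite (le_trans (ler_normB _ _))// lerD.
Qed.

(** Adding [L * x] makes the right-hand side nondecreasing in the state on
    the ball, since [L] dominates its Lipschitz constant 2 (K + G) there. *)
Lemma le_mild_integrand lambda lambda' x y s : lambda <= lambda' ->
  `|x s| <= K -> `|y s| <= K -> x s <= y s ->
  mild_integrand lambda x s <= mild_integrand lambda' y s.
Proof.
move=> lam xK yK xy; rewrite ler_wpM2l ?expR_ge0//.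
have := shifted_riccati_lipschitz p lambda gG s xK yK.
rewrite distrC (distrC (x s)) (@ger0_norm _ (y s - x s)) ?subr_ge0//.
have H : 2 * (K + G) * (y s - x s) <= L * (y s - x s).
  by rewrite ler_wpM2r// subr_ge0.
by rewrite /shifted_riccati => /ler_normlP[]; lra.
Qed.

Lemma le_mild_map lambda lambda' x y t : lambda <= lambda' ->
  `|lambda| <= Lam -> `|lambda'| <= Lam -> in_ball x -> in_ball y ->
  (forall s, x s <= y s) -> mild_map lambda x t <= mild_map lambda' y t.
Proof.
move=> ll lL lL' bx by_ xy; rewrite ler_wpM2l ?expR_ge0//.
apply: (le_primitive L0 (mild_integrand_bounded lL bx)
  (mild_integrand_bounded lL' by_)) => s _.
by apply: le_mild_integrand => //; [exact: bx.2|exact: by_.2].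
Qed.

Lemma in_ball_cst k : `|k| <= K -> in_ball (fun=> k).
Proof. by move=> kK; split. Qed.

(** The constant [K] is a supersolution, so it lies above its image. *)
Lemma mild_map_upper lambda t : `|lambda| <= Lam ->
  (forall s, f lambda s K <= 0) -> mild_map lambda (fun=> K) t <= K.
Proof.
move=> lL fK; rewrite /mild_map mulNr expRN mulrC ler_pdivrMr ?expR_gt0//.
have KK : `|K| <= K by rewrite ger0_norm.
have E : primitive (fun s => L * K * expR (L * s)) t = K * expR (L * t).
  by rewrite primitive_expR// mulrA mulrAC (mulrAC L) divff ?gt_eqF// mul1r.
rewrite -E; apply: (le_primitive L0
  (mild_integrand_bounded lL (in_ball_cst KK)) (exp_bounded_expR _ _)).
  by rewrite mulr_ge0// ltW.
by move=> s _; rewrite /mild_integrand mulrC ler_wpM2r ?expR_ge0// gerDr.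
Qed.

Lemma locally_ac_mild_map lambda x : `|lambda| <= Lam -> in_ball x ->
  locally_ac (mild_map lambda x).
Proof.
move=> lL bx; apply: locally_acM; first exact: locally_ac_expR.
exact: (locally_ac_primitive L0 (mild_integrand_bounded lL bx)).
Qed.

Lemma measurable_mild_map lambda x : `|lambda| <= Lam -> in_ball x ->
  measurable_fun setT (mild_map lambda x).
Proof.
move=> lL bx; apply: continuous_measurable_fun; apply: locally_ac_continuous.
exact: locally_ac_mild_map.
Qed.

Lemma is_derive_mild_map lambda x : `|lambda| <= Lam -> in_ball x ->
  {ae mu, forall t, is_derive t (1 : R) (mild_map lambda x)
    (f lambda t (x t) + L * (x t - mild_map lambda x t))}.
Proof.
move=> lL bx.
apply: ae_imply (is_derive_primitive_ae L0 (mild_integrand_bounded lL bx)) => t hI.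
have H := is_derive_mulR (is_derive_expR_linear (- L) t) hI.
apply: (@is_derive_eq _ _ _ _ _ _ _ _ H); rewrite /mild_map /mild_integrand.
rewrite (mulrA (expR (- L * t)) (expR _)) -expRD (mulNr L t) addNr expR0.
by ring.
Qed.

Lemma mild_map_bounded lambda x t : `|lambda| <= Lam -> in_ball x ->
  `|mild_map lambda x t| <= C / L.
Proof.
move=> lL bx; rewrite normrM ger0_norm ?expR_ge0// mulNr expRN mulrC.
rewrite ler_pdivrMr ?expR_gt0// mulrAC -mulrA.
exact: normr_primitive_le (mild_integrand_bounded lL bx).
Qed.

Lemma mild_map_cvg (lam_ : nat -> R) lambda (x_ : nat -> R -> R) x t :
  (forall n, `|lam_ n| <= Lam) -> (forall n, in_ball (x_ n)) ->
  lam_ n @[n --> \oo] --> lambda -> (forall s, x_ n s @[n --> \oo] --> x s) ->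
  mild_map (lam_ n) (x_ n) t @[n --> \oo] --> mild_map lambda x t.
Proof.
move=> lL bx lamc xc; apply: cvgMr.
apply: (primitive_cvg L0 (fun n => mild_integrand_bounded (lL n) (bx n))) => s.
apply: cvgMr; apply: cvgD; last by apply: cvgMr; exact: xc.
apply: cvgD => //; apply: cvgD; last exact: cvg_cst.
apply: cvgN; rewrite expr2.
under eq_fun do rewrite expr2.
by apply: cvgM; apply: cvgB; [exact: xc|exact: cvg_cst|exact: xc|exact: cvg_cst].
Qed.

Lemma mild_fixpoint_solution lambda x : `|lambda| <= Lam -> in_ball x ->
  (forall t, x t = mild_map lambda x t) -> caratheodory_solution (f lambda) x.
Proof.
move=> lL bx xT; have xE : x = mild_map lambda x by apply/funext.
split; first by rewrite xE; exact: locally_ac_mild_map.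
apply: ae_imply (is_derive_mild_map lL bx) => t.
by rewrite -xT subrr mulr0 addr0 -xE.
Qed.

(** The difference z = w - [mild_map lambda w] satisfies z' <= - L z. *)
Lemma subsolution_le_mild_map lambda w : `|lambda| <= Lam ->
  subsolution (f lambda) w -> (forall t, `|w t| <= K) ->
  forall t, w t <= mild_map lambda w t.
Proof.
move=> lL [acw dw] wK t.
have bw : in_ball w.
  by split=> //; apply: continuous_measurable_fun; exact: locally_ac_continuous.
suff : w t - mild_map lambda w t <= 0 by rewrite subr_le0.
apply: (@bounded_decay_le0 _ L (K + C / L) (fun t => w t - mild_map lambda w t)).
- exact: L0.
- by apply: locally_acB => //; exact: locally_ac_mild_map.
- by move=> s; rewrite (le_trans (ler_normB _ _))// lerD// mild_map_bounded.
- apply: ae_imply2 dw (is_derive_mild_map lL bw) => s [d dle hd] hT.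
  exists (d - (f lambda s (w s) + L * (w s - mild_map lambda w s))).
    by lra.
  exact: is_derive_subR.
Qed.

(** Iterating the monotone map from [w] gives a nondecreasing sequence that
    stays below [K]; dominated convergence identifies its limit as a fixed
    point. *)
Lemma mild_subsolution_solution lambda w : `|lambda| <= Lam ->
  (forall s, f lambda s K <= 0) -> in_ball w ->
  (forall t, w t <= mild_map lambda w t) -> has_bounded_solution (f lambda).
Proof.
move=> lL fK bw wT; pose x n := iter n (mild_map lambda) w.
have xS n : in_ball (x n) /\ forall t, x n t <= x n.+1 t.
  elim: n => [//|n [bx xx]].
  have bx' : in_ball (x n.+1).
    split=> [|t]; first exact: measurable_mild_map.
    rewrite ler_norml; apply/andP; split.
      by rewrite (le_trans _ (xx t))//; exact: in_ball_ge.
    apply: le_trans (mild_map_upper t lL fK); apply: le_mild_map => //.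
      by apply: in_ball_cst; rewrite ger0_norm.
    by move=> s; exact: in_ball_le.
  by split=> // t; apply: le_mild_map.
have xub n t : x n t <= K.
  exact: in_ball_le (xS n).1.
have xlb n t : - K <= x n t.
  exact: in_ball_ge (xS n).1.
have xnd t : nondecreasing_seq (x ^~ t).
  by apply/nondecreasing_seqP => n; exact: (xS n).2.
have xcv t : cvgn (x ^~ t).
  by apply: nondecreasing_is_cvgn => //; exists K => _ [n _ <-].
pose X t := limn (x ^~ t).
have xX t : x n t @[n --> \oo] --> X t by exact: xcv.
have bX : in_ball X.
  split; first by apply: (@measurable_fun_cvg _ _ _ _ x) => // n; exact: (xS n).1.1.
  move=> t; rewrite ler_norml; apply/andP; split.
    by apply: limr_ge => //; exact: nearW.
  by apply: limr_le => //; exact: nearW.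
exists X; split; last first.
  exists K; split; first exact: num_real.
  by move=> k Kk t _; rewrite /= (le_trans (bX.2 t))// ltW.
apply: mild_fixpoint_solution => // t.
have H1 : mild_map lambda (x n) t @[n --> \oo] --> mild_map lambda X t.
  by apply: mild_map_cvg => // [n|]; [exact: (xS n).1|exact: cvg_cst].
have H2 : x n.+1 t @[n --> \oo] --> X t by rewrite (cvg_shiftS (x ^~ t)); exact: xX.
by rewrite -(cvg_lim (@Rhausdorff R) H2) -(cvg_lim (@Rhausdorff R) H1).
Qed.

(** A supremum of elements below their images is below its image, by
    monotonicity.  The tail suprema of the [y_ n] decrease, and their limit is
    below its image at the limit parameter by dominated convergence. *)
Lemma mild_subsolutions_limit (lam_ : nat -> R) lambda (y_ : nat -> R -> R) :
  (forall n, `|lam_ n| <= Lam) -> `|lambda| <= Lam ->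
  nonincreasing_seq lam_ -> lam_ n @[n --> \oo] --> lambda ->
  (forall s, f lambda s K <= 0) ->
  (forall n, in_ball (y_ n)) ->
  (forall n t, y_ n t <= mild_map (lam_ n) (y_ n) t) ->
  has_bounded_solution (f lambda).
Proof.
move=> lL lamL ldec lcv fK by_ yT.
have yub n t : y_ n t <= K by exact: in_ball_le.
have ylb n t : - K <= y_ n t by exact: in_ball_ge.
(* The tail suprema over the indices k >= n. *)
pose Z n t := sups (y_ ^~ t) n.
have yub' t : has_ubound (range (y_ ^~ t)) by exists K => _ [n _ <-].
have yZ n k t : (n <= k)%N -> y_ k t <= Z n t.
  move=> nk; apply: ub_le_sup; last by exists k.
  by exists K => _ [m _ <-].
have Zle n t M : (forall k, (n <= k)%N -> y_ k t <= M) -> Z n t <= M.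
  move=> H; apply: ge_sup; first by exists (y_ n t), n => /=.
  by move=> _ [k nk <-]; exact: H.
have bZ n : in_ball (Z n).
  split; first by apply: measurable_fun_sups => // m; exact: (by_ m).1.
  move=> t; rewrite ler_norml (le_trans (ylb n t) (yZ _ _ _ _))//=.
  by apply: Zle => k _.
have ZT n t : Z n t <= mild_map (lam_ n) (Z n) t.
  apply: Zle => k nk; apply: le_trans (yT k t) _.
  by apply: le_mild_map => // [|s]; [exact: ldec|exact: yZ].
have Zcv t : cvgn (Z ^~ t).
  apply: nonincreasing_is_cvgn.
    apply/nonincreasing_seqP => n; apply: Zle => k nk; apply: yZ.
    exact: ltnW.
  exists (- K) => _ [n _ <-]; by rewrite (le_trans (ylb n t))// yZ.
pose Y t := limn (Z ^~ t).
have ZY t : Z n t @[n --> \oo] --> Y t by exact: Zcv.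
have Zub n t : Z n t <= K by exact: in_ball_le.
have Zlb n t : - K <= Z n t by exact: in_ball_ge.
have bY : in_ball Y.
  split; first by apply: (@measurable_fun_cvg _ _ _ _ Z) => // n; exact: (bZ n).1.
  move=> t; rewrite ler_norml; apply/andP; split.
    by apply: limr_ge => //; exact: nearW.
  by apply: limr_le => //; exact: nearW.
apply: (mild_subsolution_solution lamL fK bY) => t.
have H := mild_map_cvg (t := t) lL bZ lcv ZY.
rewrite -(cvg_lim (@Rhausdorff R) H); apply: ler_lim.
- exact: Zcv.
- by apply/cvg_ex; eexists; exact: H.
- exact: nearW.
Qed.

End MildSolutions.

(** * Existence of the bifurcation value and its perturbation *)

Section BifurcationValue.
Context {R : realType}.
Notation mu := (@lebesgue_measure R).
Implicit Types (lambda s t : R) (w x y : R -> R).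

Definition bounded_measurable (G : R) (g : R -> R) : Prop :=
  measurable_fun setT g /\ forall t, `|g t| <= G.

Section one_equation.
Variables (g p : R -> R) (G P : R).
Hypotheses (gG : bounded_measurable G g) (pP : bounded_measurable P p).
Local Notation f := (shifted_riccati g p).

Let G0 : 0 <= G. Proof. exact: le_trans (gG.2 0). Qed.
Let P0 : 0 <= P. Proof. exact: le_trans (pP.2 0). Qed.

Lemma bounded_subsolution_solution lambda w B : subsolution (f lambda) w ->
  (forall t, `|w t| <= B) -> has_bounded_solution (f lambda).
Proof.
move=> subw wB; pose K := apriori_bound G P lambda.
have K0 : 0 < K := apriori_bound_gt0 lambda gG.2 pP.2.
have wK : forall t, `|w t| <= K := subsolution_apriori gG.2 pP.2 subw wB.
have KL : 2 * (K + G) <= 2 * (K + G) + 1 by rewrite lerDl.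
have L0 : 0 < 2 * (K + G) + 1 by rewrite ltr_wpDl// mulr_ge0// addr_ge0// ltW.
apply: (mild_subsolution_solution gG.1 pP.1 gG.2 pP.2 (ltW K0) L0 KL (lexx _)
  (w := w)).
- move=> s; apply: (@le_trans _ _ (- 1)); last by rewrite lerN10.
  by apply: (shifted_riccati_lt_m1 gG.2 pP.2); exact: ler_norm.
- split=> //; apply: continuous_measurable_fun; exact: locally_ac_continuous subw.1.
- exact: (subsolution_le_mild_map gG.1 pP.1 gG.2 pP.2 (ltW K0) L0 (lexx _) subw wK).
Qed.

Lemma bounded_solution_subsolution lambda : has_bounded_solution (f lambda) ->
  exists2 w, subsolution (f lambda) w &
    forall t, `|w t| <= apriori_bound G P lambda.
Proof.
move=> [x [/caratheodory_subsolution subx [M [_ xM]]]]; exists x => // t.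
apply: (subsolution_apriori gG.2 pP.2 subx (B := M + 1)) => s.
by apply: (xM (M + 1) _ s) => //; rewrite ltrDl.
Qed.

Lemma has_bounded_solution_up lambda lambda' : lambda <= lambda' ->
  has_bounded_solution (f lambda) -> has_bounded_solution (f lambda').
Proof.
move=> ll /bounded_solution_subsolution[w [acw dw] wK].
apply: (bounded_subsolution_solution _ wK); split=> //.
apply: ae_imply dw => t [d dle hd]; exists d => //.
by apply: le_trans dle _; rewrite lerD2l.
Qed.

(** At this parameter the constant 0 is a subsolution, since
    - g^2 + p + P + G^2 >= 0. *)
Lemma has_bounded_solution_upper : has_bounded_solution (f (P + G ^+ 2)).
Proof.
apply: (@bounded_subsolution_solution _ (fun=> 0) 0); last by move=> t; rewrite normr0.
split; first exact: locally_ac_cst.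
apply: aeW => t; exists 0; last exact: is_derive_cst.
rewrite /shifted_riccati sub0r sqrrN.
have := pP.2 t => /ler_normlP[pl _].
have : g t ^+ 2 <= G ^+ 2.
  by rewrite -(real_normK (num_real (g t))) lerXn2r ?nnegrE// gG.2.
lra.
Qed.

Lemma has_bounded_solution_lower lambda :
  has_bounded_solution (f lambda) -> - P <= lambda.
Proof.
move=> /bounded_solution_subsolution[w subw wK].
exact: (subsolution_lambda_ge gG.2 pP.2 subw wK).
Qed.

(** Solutions at the parameters lambda + 1 / (n + 1) share one a priori
    bound, so [mild_subsolutions_limit] applies to them. *)
Lemma has_bounded_solution_closed lambda :
  (forall e, 0 < e -> has_bounded_solution (f (lambda + e))) ->
  has_bounded_solution (f lambda).
Proof.
move=> H; pose Lam := `|lambda| + 1.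
have Lam0 : 0 <= Lam by rewrite addr_ge0.
pose K := apriori_bound G P Lam.
have K0 : 0 < K := apriori_bound_gt0 Lam gG.2 pP.2.
have KL : 2 * (K + G) <= 2 * (K + G) + 1 by rewrite lerDl.
have L0 : 0 < 2 * (K + G) + 1 by rewrite ltr_wpDl// mulr_ge0// addr_ge0// ltW.
have lK lam : `|lam| <= Lam -> apriori_bound G P lam <= K.
  by move=> lL; rewrite /K /apriori_bound (ger0_norm Lam0) lerD2r lerD2l.
pose e_ (n : nat) : R := n.+1%:R^-1.
have e0 n : 0 < e_ n by rewrite invr_gt0.
have e1 n : e_ n <= 1 by rewrite invf_le1// ler1n.
have lL n : `|lambda + e_ n| <= Lam.
  by rewrite (le_trans (ler_normD _ _))// lerD2l gtr0_norm.
have lL0 : `|lambda| <= Lam by rewrite lerDl.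
have /choice[y yP] n : exists w, subsolution (f (lambda + e_ n)) w /\
    forall t, `|w t| <= K.
  have [w subw wK] := bounded_solution_subsolution (H _ (e0 n)).
  by exists w; split=> // t; exact: le_trans (wK t) (lK _ (lL n)).
apply: (@mild_subsolutions_limit _ g p G P K _ Lam gG.1 pP.1 gG.2 pP.2 (ltW K0) L0
  KL (fun n => lambda + e_ n) lambda y) => //.
- apply/nonincreasing_seqP => n; rewrite lerD2l lef_pV2 ?posrE//.
  by rewrite ler_nat.
- rewrite -[X in _ --> X]addr0; apply: cvgD; first exact: cvg_cst.
  exact: cvg_harmonic.
- move=> s; apply: (@le_trans _ _ (- 1)); last by rewrite lerN10.
  apply: (shifted_riccati_lt_m1 gG.2 pP.2); apply: le_trans (ler_norm _).
  exact: lK.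
- move=> n; have [subw wK] := yP n; split=> //.
  apply: continuous_measurable_fun; exact: locally_ac_continuous subw.1.
- move=> n t; have [subw wK] := yP n.
  exact: (subsolution_le_mild_map gG.1 pP.1 gG.2 pP.2 (ltW K0) L0).
Qed.

Definition bifurcation_value : R :=
  lambda_star (fun t => 2 * g t) (fun t => p t - g t ^+ 2).

Lemma bifurcation_valueP lambda :
  has_bounded_solution (f lambda) <-> bifurcation_value <= lambda.
Proof.
pose S := [set lambda | has_bounded_solution (f lambda)].
have infS : has_inf S.
  split; first by exists (P + G ^+ 2); exact: has_bounded_solution_upper.
  by exists (- P) => l; exact: has_bounded_solution_lower.
have bif : is_bifurcation_value (fun t => 2 * g t) (fun t => p t - g t ^+ 2) (inf S).
  move=> l; rewrite riccati_shift; split=> [Sl|].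
    by apply: ge_inf => //; exact: infS.2.
  move=> infl; apply: (has_bounded_solution_up infl).
  apply: has_bounded_solution_closed => e e0.
  have [l' Sl' l'e] := inf_adherent e0 infS.
  exact: has_bounded_solution_up (ltW l'e) Sl'.
have := @xgetPex _ 0 [set l | is_bifurcation_value (fun t => 2 * g t)
  (fun t => p t - g t ^+ 2) l].
by move=> /(_ (ex_intro _ _ bif))/(_ lambda); rewrite riccati_shift.
Qed.

Lemma bifurcation_value_bounds : - P <= bifurcation_value <= P + G ^+ 2.
Proof.
apply/andP; split; last by apply/bifurcation_valueP; exact: has_bounded_solution_upper.
by apply: has_bounded_solution_lower; apply/bifurcation_valueP.
Qed.

Lemma bifurcation_value_norm : `|bifurcation_value| <= P + G ^+ 2.
Proof.
have /andP[l1 l2] := bifurcation_value_bounds.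
rewrite ler_norml l2 andbT (le_trans _ l1)// lerN2 lerDl exprn_ge0//.
Qed.

End one_equation.

Section perturbation.
Variables (p : R -> R) (G P : R).
Hypotheses (pP : bounded_measurable P p).
Local Notation lstar g := (bifurcation_value g p).

(** Bounds |2 y + D - g1 - g2| when [y] is a bounded solution at the
    bifurcation value, |D| <= B and |g1|, |g2| <= G; that factor comes from
    (y + D - g2)^2 - (y - g1)^2 = (D - (g2 - g1)) (2 y + D - g1 - g2). *)
Definition perturbation_const (B : R) : R :=
  2 * (apriori_bound G P (P + G ^+ 2) + G) + B.

Lemma perturbation_const_ge B : 0 <= G -> 0 <= B -> B <= perturbation_const B.
Proof.
move=> G0 B0; have P0 : 0 <= P := le_trans (normr_ge0 _) (pP.2 0).
by rewrite lerDr mulr_ge0// addr_ge0// !addr_ge0.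
Qed.

(** If [y] is a bounded solution for [g1], then [y + D] is a bounded
    subsolution for [g2] at the parameter raised by [e]. *)
Lemma bifurcation_value_perturbation (g1 g2 D : R -> R) (B e : R) :
  bounded_measurable G g1 -> bounded_measurable G g2 ->
  locally_ac D -> (forall t, `|D t| <= B) ->
  {ae mu, forall t, exists2 d,
     d + perturbation_const B * `|D t - (g2 t - g1 t)| <= e &
     is_derive t (1 : R) D d} ->
  lstar g2 <= lstar g1 + e.
Proof.
move=> g1G g2G acD DB dD.
have /(bifurcation_valueP g1G pP) := lexx (lstar g1).
move=> /(bounded_solution_subsolution g1G pP)[y [acy dy] yK].
have {}yK t : `|y t| <= apriori_bound G P (P + G ^+ 2).
  apply: le_trans (yK t) _; rewrite /apriori_bound lerD2r lerD2l.
  by rewrite (le_trans (bifurcation_value_norm g1G pP))// ler_norm.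
apply/(bifurcation_valueP g2G pP).
apply: (@bounded_subsolution_solution _ _ G P g2G pP _ (fun t => y t + D t)
  (apriori_bound G P (P + G ^+ 2) + B)); last first.
  by move=> t; rewrite (le_trans (ler_normD _ _))// lerD.
split; first exact: locally_acD.
apply: ae_imply2 dy dD => t [dy dyle hy] [d dle hd].
exists (dy + d); last exact: is_derive_addR.
rewrite /shifted_riccati in dyle *.
set z := D t - (g2 t - g1 t) in dle.
have -> : (y t + D t - g2 t) ^+ 2 =
    (y t - g1 t) ^+ 2 + z * (2 * y t + D t - g1 t - g2 t) by rewrite /z; ring.
suff : z * (2 * y t + D t - g1 t - g2 t) <= perturbation_const B * `|z| by lra.
rewrite (le_trans (ler_norm _))// normrM mulrC ler_wpM2r//.
have := yK t; have := DB t; have := g1G.2 t; have := g2G.2 t.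
rewrite /perturbation_const !ler_norml => /andP[? ?] /andP[? ?] /andP[? ?] /andP[? ?].
by apply/andP; split; lra.
Qed.

End perturbation.
End BifurcationValue.

(** * Two sufficient conditions for nearby bifurcation values *)

Section Closeness.
Context {R : realType}.
Notation mu := (@lebesgue_measure R).
Variables (p : R -> R) (G P : R).
Hypotheses (G0 : 0 <= G) (pP : bounded_measurable P p).
Local Notation lstar g := (bifurcation_value g p).
Implicit Types (g : R -> R) (e s t T : R).

Lemma bounded_measurableB g1 g2 : bounded_measurable G g1 ->
  bounded_measurable G g2 -> bounded_measurable (G + G) (fun t => g2 t - g1 t).
Proof.
move=> [m1 b1] [m2 b2]; split; first exact: measurable_funB.
by move=> t; rewrite (le_trans (ler_normB _ _))// lerD.
Qed.

(** A function cut off to [-T, T] has an exponential bound of rate 1: the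
    constant C exp(T) exp(s) is at least C there. *)
Lemma primitive_restrict_bounds (h : R -> R) C T t :
  bounded_measurable C h -> (forall s, 0 <= h s) ->
  exp_bounded 1 (C * expR T) (h \_ `[- T, T]) /\
  0 <= primitive (h \_ `[- T, T]) t <= \int[mu]_(s in `[- T, T]) h s.
Proof.
move=> [mh hC] h0; have C0 : 0 <= C := le_trans (normr_ge0 _) (hC 0).
have hr s : 0 <= (h \_ `[- T, T]) s by rewrite patchE; case: ifP.
split.
  split; first by apply/(measurable_restrictT _ _).1 => //; exact: measurable_funTS.
  move=> s; rewrite patchE; case: ifPn => [|_]; last first.
    by rewrite normr0 !mulr_ge0// expR_ge0.
  rewrite inE/= in_itv/= => /andP[Ts sT].
  rewrite (le_trans (hC s))// -mulrA -expRD ler_peMr// -[leLHS]expR0 ler_expR mul1r; lra.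
apply/andP; split; first exact: Rintegral_ge0.
have ih : mu.-integrable `[- T, T] (EFin \o h).
  apply: measurable_bounded_integrable => //.
  - rewrite [X in (X < _)%E](lebesgue_measure_itv `[- T, T]) /=.
    by case: ifP => _; rewrite ?ltry// -EFinB ltry.
  - exact: measurable_funTS.
  - exists C; split; first exact: num_real.
    by move=> M CM s _; rewrite /= (le_trans (hC s))// ltW.
rewrite /primitive -Rintegral_mkcondr; apply: fine_le.
- apply: integrable_fin_num; first exact: measurableI.
  by apply: integrableS ih => //; exact: measurableI.
- exact: integrable_fin_num.
- apply: ge0_subset_integral => //; first exact: measurableI.
    by apply/measurable_EFinP; exact: measurable_funTS.
  by move=> s _; rewrite lee_fin.
Qed.

(** Take D(t) = - M int of |g2 - g1| over [-T, T] up to t.  Inside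
    [-T, T] its derivative cancels M |g2 - g1|, outside that term is small by
    assumption, and |D| <= M eta everywhere. *)
Lemma bifurcation_value_integral_close e : 0 < e -> exists2 eta, 0 < eta &
  forall g1 g2, bounded_measurable G g1 -> bounded_measurable G g2 ->
  forall T, (forall t, T < `|t| -> `|g2 t - g1 t| <= eta) ->
  \int[mu]_(s in `[- T, T]) `|g2 s - g1 s| <= eta ->
  `|lstar g2 - lstar g1| <= e.
Proof.
move=> e0; pose M := perturbation_const G P 1.
have M1 : 1 <= M := perturbation_const_ge pP G0 ler01.
have M0 : 0 < M := lt_le_trans ltr01 M1.
have MM0 : 0 < M * M + M by rewrite addr_gt0// mulr_gt0.
(* The first term keeps |D| <= 1; the second covers M |D| + M |g2 - g1|. *)
pose eta := Num.min (M^-1) (e / (M * M + M)).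
have eta0 : 0 < eta by rewrite lt_min invr_gt0 M0 divr_gt0.
have etaM : M * eta <= 1 by rewrite mulrC -ler_pdivlMr// div1r ge_min lexx.
have etae : (M * M + M) * eta <= e.
  by rewrite mulrC -ler_pdivlMr// ge_min lexx orbT.
have oneside g1 g2 T : bounded_measurable G g1 -> bounded_measurable G g2 ->
    (forall t, T < `|t| -> `|g2 t - g1 t| <= eta) ->
    \int[mu]_(s in `[- T, T]) `|g2 s - g1 s| <= eta ->
    lstar g2 <= lstar g1 + e.
  move=> b1 b2 out int_le.
  pose h t := `|g2 t - g1 t|; pose phi := h \_ `[- T, T].
  have bh : bounded_measurable (G + G) h.
    have [m b] := bounded_measurableB b1 b2; split; last by move=> t; rewrite normr_id.
    exact: measurableT_comp.
  have h0 s : 0 <= h s by exact: normr_ge0.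
  have bphi := (primitive_restrict_bounds T 0 bh h0).1.
  have I t : 0 <= primitive phi t <= eta.
    have [_ /andP[-> /le_trans]] := primitive_restrict_bounds T t bh h0.
    exact.
  apply: (bifurcation_value_perturbation pP (D := fun t => - M * primitive phi t)
    (B := 1) b1 b2).
  - apply: locally_acM; first exact: locally_ac_cst.
    exact: (locally_ac_primitive ltr01 bphi).
  - move=> t; have /andP[I0 I1] := I t.
    rewrite mulNr normrN ger0_norm ?mulr_ge0 ?(ltW M0)//.
    by rewrite (le_trans _ etaM)// ler_pM2l.
  - apply: ae_imply (is_derive_primitive_ae ltr01 bphi) => t hI.
    exists (- M * phi t); last first.
      have := is_derive_mulR (is_derive_cst (- M) t (1 : R)) hI.
      by rewrite mul0r add0r.
    have /andP[I0 I1] := I t; rewrite -/M.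
    have hphi : h t - phi t <= eta.
      rewrite /phi patchE; case: ifPn => [_|]; first by rewrite subrr ltW.
      rewrite notin_setE/= in_itv/= => /negP; rewrite -ler_norml -ltNge => Tt.
      by rewrite subr0; exact: out.
    have DI : `|- M * primitive phi t - (g2 t - g1 t)| <= M * primitive phi t + h t.
      rewrite (le_trans (ler_normB _ _))// mulNr normrN ger0_norm//.
      by rewrite mulr_ge0// ltW.
    have H1 : M * `|- M * primitive phi t - (g2 t - g1 t)| <=
      M * (M * primitive phi t + h t) by rewrite ler_pM2l.
    have H2 : M * (h t - phi t) <= M * eta by rewrite ler_pM2l.
    have H3 : M * (M * primitive phi t) <= M * (M * eta) by rewrite !ler_pM2l.
    lra.
exists eta => // g1 g2 b1 b2 T out int_le.
have h12 := oneside _ _ _ b1 b2 out int_le.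
have h21 : lstar g1 <= lstar g2 + e.
  apply: (oneside _ _ T b2 b1) => [t /out|]; first by rewrite distrC.
  by under eq_Rintegral do rewrite distrC.
by rewrite ler_norml; apply/andP; split; lra.
Qed.

(** The moving average int_{-oo}^t e^{-(t - s)} d(s) ds, which solves
    D' = d - D. *)
Definition exp_average (d : R -> R) t : R :=
  expR (- 1 * t) * primitive (fun s => d s * expR (1 * s)) t.

Lemma exp_average_bounded C d : bounded_measurable C d ->
  exp_bounded 1 C (fun s => d s * expR (1 * s)).
Proof.
move=> [md dC]; split=> [|s].
  apply: measurable_funM => //; apply: continuous_measurable_fun.
  exact: continuous_expR_linear.
by rewrite normrM (ger0_norm (expR_ge0 _)) ler_wpM2r ?expR_ge0.
Qed.

Lemma is_derive_exp_average C d : bounded_measurable C d ->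
  {ae mu, forall t, is_derive t (1 : R) (exp_average d) (d t - exp_average d t)}.
Proof.
move=> /exp_average_bounded bd.
apply: ae_imply (is_derive_primitive_ae ltr01 bd) => t hI.
have H := is_derive_mulR (is_derive_expR_linear (- 1) t) hI.
apply: (@is_derive_eq _ _ _ _ _ _ _ _ H); rewrite /exp_average.
rewrite mulrCA -expRD (mulNr 1 t) addNr expR0.
by ring.
Qed.

Lemma exp_average_norm C d t : bounded_measurable C d -> `|exp_average d t| <= C.
Proof.
move=> /exp_average_bounded bd.
rewrite normrM ger0_norm ?expR_ge0// mulNr expRN mulrC.
rewrite ler_pdivrMr ?expR_gt0// (le_trans (normr_primitive_le ltr01 t bd))//.
by rewrite divr1.
Qed.

(** Bound t - s by 2 exp((t - s) / 2) under the integral, so that both terms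
    integrate to pure exponentials; this is where the factor 2 (a + 2 b)
    comes from. *)
Lemma exp_average_le C d a b t : bounded_measurable C d -> 0 <= a -> 0 <= b ->
  (forall s, s <= t -> d s <= d t + (a + b * (t - s))) ->
  exp_average d t <= d t + 2 * (a + 2 * b).
Proof.
move=> bd a0 b0 H; have bd1 := exp_average_bounded bd.
have k0 : 0 < (2^-1 : R) by rewrite invr_gt0.
pose A := (a + 2 * b) * expR (2^-1 * t).
have i1 := exp_integrable ltr01 (d t) t; have i2 := exp_integrable k0 A t.
rewrite /exp_average mulNr expRN mulrC ler_pdivrMr ?expR_gt0//.
apply: (@le_trans _ _ (\int[mu]_(s in `]-oo, t])
    (d t * expR (1 * s) + A * expR (2^-1 * s)))).
  apply: le_Rintegral => //.
  - exact: (exp_bounded_integrable ltr01 t bd1).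
  - by have := integrableD _ i1 i2; apply => //.
  - move=> s; rewrite /= in_itv/= => st.
    have ts : 0 <= t - s by rewrite subr_ge0.
    have := H _ st; rewrite -(ler_pM2r (expR_gt0 (1 * s))) => /le_trans; apply.
    rewrite mulrDl lerD2l /A -mulrA -expRD.
    have E : expR (1 * s) * expR (2^-1 * (t - s)) = expR (2^-1 * t + 2^-1 * s).
      by rewrite -expRD; congr expR; field.
    rewrite -E [leRHS]mulrCA mulrC ler_wpM2l ?expR_ge0//.
    have := expR_ge1Dx (2^-1 * (t - s)); set X := expR _ => HX.
    have X1 : 1 <= X by rewrite (le_trans _ HX)// lerDl mulr_ge0// ltW.
    have : a <= a * X by rewrite ler_peMr.
    have : b * (t - s) <= b * (2 * X) by rewrite ler_wpM2l//; lra.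
    by lra.
rewrite RintegralD//.
have := primitive_expR ltr01 (d t) t; rewrite /primitive => ->.
have := primitive_expR k0 A t; rewrite /primitive => ->.
have E : expR (2^-1 * t) * expR (2^-1 * t) = expR (1 * t).
  by rewrite -expRD; congr expR; field.
rewrite divr1 invrK mulrDl lerD2l /A -mulrA [X in _ * X]mulrA E.
by rewrite le_eqVlt; apply/orP; left; apply/eqP; ring.
Qed.

(** Take for D the exponential average of d = g2 - g1: then D' = d - D, so
    the perturbation condition only asks that D stay close to d, and it does
    when d is slow. *)
Lemma bifurcation_value_slow_close e : 0 < e -> exists2 eta, 0 < eta &
  forall g1 g2, bounded_measurable G g1 -> bounded_measurable G g2 ->
  forall a b, 0 <= a -> 0 <= b ->
  (forall s t, s <= t ->
     `|(g2 s - g1 s) - (g2 t - g1 t)| <= a + b * (t - s)) ->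
  2 * (a + 2 * b) <= eta ->
  `|lstar g2 - lstar g1| <= e.
Proof.
move=> e0; pose M := perturbation_const G P (G + G).
have GG0 : 0 <= G + G by rewrite addr_ge0.
have M0 : 0 <= M := le_trans GG0 (perturbation_const_ge pP G0 GG0).
have M1 : 0 < 1 + M by rewrite ltr_pwDl.
exists (e / (1 + M)) => [|g1 g2 b1 b2 a b a0 b0 H ab]; first by rewrite divr_gt0.
have oneside g g' : bounded_measurable G g -> bounded_measurable G g' ->
    (forall s t, s <= t ->
       `|(g' s - g s) - (g' t - g t)| <= a + b * (t - s)) ->
    lstar g' <= lstar g + e.
  move=> {b1 b2 H} b1 b2 H; pose d t := g' t - g t.
  have bd : bounded_measurable (G + G) d := bounded_measurableB b1 b2.
  have bdN : bounded_measurable (G + G) (fun t => - d t).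
    by split=> [|t]; [exact: measurableT_comp bd.1|rewrite normrN; exact: bd.2].
  have aN t : exp_average (fun s => - d s) t = - exp_average d t.
    rewrite /exp_average -mulrN; congr (_ * _).
    rewrite -(primitiveN ltr01 _ (exp_average_bounded bd)).
    by congr primitive; apply/funext => s; rewrite mulNr.
  have Dd t : `|exp_average d t - d t| <= 2 * (a + 2 * b).
    rewrite ler_norml; apply/andP; split.
      have : exp_average (fun s => - d s) t <= - d t + 2 * (a + 2 * b).
        apply: (exp_average_le bdN a0 b0) => s st.
        by have := H _ _ st => /ler_normlP[]; rewrite /d; lra.
      by rewrite aN; lra.
    have : exp_average d t <= d t + 2 * (a + 2 * b).
      apply: (exp_average_le bd a0 b0) => s st.
      by have := H _ _ st => /ler_normlP[]; rewrite /d; lra.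
    by lra.
  apply: (bifurcation_value_perturbation pP (D := exp_average d) (B := G + G) b1 b2).
  - apply: locally_acM; first exact: locally_ac_expR.
    exact: (locally_ac_primitive ltr01 (exp_average_bounded bd)).
  - by move=> t; exact: exp_average_norm.
  - apply: ae_imply (is_derive_exp_average bd) => t hD.
    exists (d t - exp_average d t) => //; rewrite -/M -/(d t).
    have : (1 + M) * `|exp_average d t - d t| <= e.
      rewrite mulrC -ler_pdivlMr//; exact: le_trans (Dd t) ab.
    have := ler_norm (d t - exp_average d t); rewrite distrC; lra.
have h12 := oneside _ _ b1 b2 H.
have h21 : lstar g1 <= lstar g2 + e.
  apply: (oneside _ _ b2 b1) => s t /H; rewrite -normrN; congr (`|_| <= _); ring.
by rewrite ler_norml; apply/andP; split; lra.
Qed.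

End Closeness.

(** * Measurability of BPUC functions *)

Section Regularity.
Context {R : realType}.
Notation mu := (@lebesgue_measure R).
Implicit Types (q : R -> R) (c h s t T : R).

Lemma measurable_fun_floor_int (phi : int -> R) c : 0 < c ->
  measurable_fun setT (fun t => phi (Num.floor (t * c))).
Proof.
move=> c0 _ Y mY; rewrite setTI.
pose F (t : R) : R := (Num.floor (t * c))%:~R.
have mF : measurable_fun setT F.
  apply: nondecreasing_measurable => // s t st.
  by rewrite ler_int le_floor// ler_pM2r.
have -> : (fun t => phi (Num.floor (t * c))) @^-1` Y =
    \bigcup_(z : int) (if `[< Y (phi z) >] then F @^-1` [set z%:~R] else set0).
  apply/seteqP; split=> [t /= Yt|t [z _]].
    by exists (Num.floor (t * c)) => //; rewrite asboolT.
  by case: asboolP => //= Yz /intr_inj ->.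
apply: countable_bigcupT_measurable => [|z]; first exact: countableP.
case: ifP => // _.
by rewrite -[X in measurable X]setTI; apply: mF.
Qed.

(** Sampling [q] at the next point of a grid of mesh 1 / (n + 1) strictly to
    the right gives step functions that converge to [q] by
    right-continuity. *)
Lemma right_continuous_measurable q :
  (forall t, q s @[s --> t^'+] --> q t) -> measurable_fun setT q.
Proof.
move=> rq.
pose u n t : R := ((Num.floor (t * n.+1%:R))%:~R + 1) / n.+1%:R.
apply: (@measurable_fun_cvg _ _ _ _ (fun n t => q (u n t))) => [n|t _].
  exact: (measurable_fun_floor_int (fun z => q ((z%:~R + 1) / n.+1%:R))).
have tu n : t < u n t <= t + n.+1%:R^-1.
  have n0 : 0 < n.+1%:R :> R by [].
  have fl := floor_le (t * n.+1%:R); have lf := floorD1_gt (t * n.+1%:R).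
  rewrite intrD in lf.
  rewrite /u ltr_pdivlMr// lf/= ler_pdivrMr// mulrDl mulVf ?gt_eqF//.
  by rewrite lerD2r.
apply: ((cvg_at_rightP _ _ _).1 (rq t) (u ^~ t)); split=> [n|].
  by have /andP[] := tu n.
apply: (@squeeze_cvgr _ _ _ _ (fun=> t) (fun n => t + n.+1%:R^-1)).
- by apply: nearW => n; have /andP[/ltW -> ->] := tu n.
- exact: cvg_cst.
- rewrite -[X in _ --> X]addr0; apply: cvgD; first exact: cvg_cst.
  exact: cvg_harmonic.
Qed.

Lemma supnorm_ge q C t : (forall s, `|q s| <= C) -> `|q t| <= supnorm q.
Proof.
move=> qC; apply: ub_le_sup; last by exists t.
by exists C => _ [s _ <-].
Qed.

Lemma bounded_funP q : bounded_fun q -> exists C, forall t, `|q t| <= C.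
Proof.
move=> [M [_ HM]]; exists (M + 1) => t.
by apply: (HM (M + 1) _ t) => //; rewrite ltrDl.
Qed.

Lemma BPUC_bounded_measurable q : BPUC q -> bounded_measurable (supnorm q) q.
Proof.
move=> [n [a [r [ar qE]]]]; split.
  rewrite qE; apply: measurable_sum => i.
  by apply: right_continuous_measurable; have [_ []] := ar i.
have /choice[C rC] (i : 'I_n) : exists C, forall t, `|r i t| <= C.
  by apply: bounded_funP; have [_ []] := ar i.
move=> t; apply: (@supnorm_ge _ (\sum_(i < n) C i)) => s; rewrite qE.
by rewrite (le_trans (ler_norm_sum _ _ _))// ler_sum.
Qed.

End Regularity.

(** * The transition profile *)

Section Profile.
Context {R : realType}.
Variables (Gamma : R -> R) (gm gp : R).
Hypotheses (Gamma_cont : continuous Gamma)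
  (Gamma_ninfty : Gamma t @[t --> -oo] --> gm)
  (Gamma_pinfty : Gamma t @[t --> +oo] --> gp).
Implicit Types (h s t T e : R) (c : \bar R).

Lemma profile_tails e : 0 < e -> exists2 T, 0 < T &
  (forall x, T <= x -> `|Gamma x - gp| <= e) /\
  (forall x, x <= - T -> `|Gamma x - gm| <= e).
Proof.
move=> e0.
have [M1 [_ H1]] := (cvgrPdist_le _ _).1 Gamma_pinfty e e0.
have [M2 [_ H2]] := (cvgrPdist_le _ _).1 Gamma_ninfty e e0.
exists (`|M1| + `|M2| + 1) => [|]; first by rewrite ltr_wpDl// addr_ge0.
have n1 := ler_norm M1; have n2 := ler_norm (- M2); rewrite normrN in n2.
have n3 := normr_ge0 M1; have n4 := normr_ge0 M2.
by split=> x Tx; rewrite distrC; [apply: H1|apply: H2]; lra.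
Qed.

Lemma profile_bounded : exists C, forall x, `|Gamma x| <= C.
Proof.
have [T T0 [H1 H2]] := profile_tails ltr01.
have NTT : - T <= T by lra.
have [M M0 HM] := continuous_bounded_itv Gamma_cont NTT.
exists (M + `|gp| + `|gm| + 1) => x.
have n1 := normr_ge0 gp; have n2 := normr_ge0 gm.
have [Tx|xT] := leP T x.
  by have := ler_normD (Gamma x - gp) gp; rewrite subrK; have := H1 _ Tx; lra.
have [xT'|Tx] := leP x (- T).
  by have := ler_normD (Gamma x - gm) gm; rewrite subrK; have := H2 _ xT'; lra.
have := HM x; rewrite (ltW xT) (ltW Tx) => /(_ isT); lra.
Qed.

Lemma profile_supnorm x : `|Gamma x| <= supnorm Gamma.
Proof. have [C HC] := profile_bounded; exact: supnorm_ge HC. Qed.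

Lemma profile_limit_supnorm : `|gm| <= supnorm Gamma /\ `|gp| <= supnorm Gamma.
Proof.
split.
  have H : `|Gamma x| @[x --> -oo] --> `|gm| by exact: cvg_norm.
  rewrite -(cvg_lim (@Rhausdorff R) H); apply: limr_le.
    by apply/cvg_ex; exists `|gm|.
  by apply: nearW => x; exact: profile_supnorm.
have H : `|Gamma x| @[x --> +oo] --> `|gp| by exact: cvg_norm.
rewrite -(cvg_lim (@Rhausdorff R) H); apply: limr_le.
  by apply/cvg_ex; exists `|gp|.
by apply: nearW => x; exact: profile_supnorm.
Qed.

(** Compactness of a segment and the limits at infinity give uniform
    continuity; the affine form of the modulus then follows from
    boundedness. *)
Lemma profile_uniform_continuity e : 0 < e -> exists2 b, 0 <= b &
  forall x y, `|Gamma x - Gamma y| <= e + b * `|x - y|.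
Proof.
move=> e0; have e40 : 0 < e / 4 by rewrite divr_gt0.
have [T T0 [H1 H2]] := profile_tails e40.
have S0 : 0 <= supnorm Gamma := le_trans (normr_ge0 _) (profile_supnorm 0).
suff [d d0 Hd] : exists2 d, 0 < d &
    forall x y, `|x - y| < d -> `|Gamma x - Gamma y| <= e.
  exists ((supnorm Gamma + supnorm Gamma) / d) => [|x y].
    by rewrite divr_ge0 ?addr_ge0// ltW.
  have [xyd|dxy] := ltP `|x - y| d.
    by rewrite (le_trans (Hd _ _ xyd))// lerDl mulr_ge0// divr_ge0 ?addr_ge0// ltW.
  rewrite (le_trans (ler_normB _ _))//.
  apply: (@le_trans _ _ (supnorm Gamma + supnorm Gamma)).
    by rewrite lerD ?profile_supnorm.
  rewrite mulrAC ler_wpDl ?(ltW e0)// ler_pdivlMr// ler_wpM2l// addr_ge0//.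
have /compact_near_coveringP/(_ R (0^'+) (fun d x => forall y, `|x - y| < d ->
    `|Gamma x - Gamma y| <= e) _) := @segment_compact R (- T - 1) (T + 1).
case=> [x _|d0 /= d00 Hd].
  have e20 : 0 < e / 2 by rewrite divr_gt0.
  have /nbhs_ballP[r /= r0 rH] : nbhs x [set t | `|Gamma x - Gamma t| < e / 2].
    exact: (cvgrPdist_lt _ _).1 (@Gamma_cont x) _ e20.
  have r20 : 0 < r / 2 by rewrite divr_gt0.
  exists (ball x (r / 2), [set d | d < r / 2]) => /=.
    split; first exact: nbhsx_ballx.
    by apply: nbhs_right_lt.
  move=> [x' d] /= [xx' dr] y x'y.
  rewrite /ball/= in xx'.
  have h1 := rH x'; have h2 := rH y; rewrite /ball/= in h1 h2.
  have /h1 {}h1 : `|x - x'| < r by lra.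
  have /h2 {}h2 : `|x - y| < r.
    by have := ler_normD (x - x') (x' - y); rewrite addrA subrK; lra.
  have := ler_normB (Gamma x - Gamma y) (Gamma x - Gamma x').
  rewrite (_ : _ - _ - _ = Gamma x' - Gamma y); last by ring.
  lra.
pose d := Num.min (d0 / 2) 1.
have d_gt0 : 0 < d by rewrite lt_min divr_gt0//=.
have dd0 : `|0 - d| < d0.
  by rewrite sub0r normrN gtr0_norm// /d gt_min; apply/orP; left; lra.
have d1 : d <= 1 by rewrite /d ge_min lexx orbT.
exists d => // x y xyd.
have := Hd d dd0 d_gt0 x; case: (ltP x (- T - 1)) => [xT _|Tx].
  have := ler_normB (Gamma x - gm) (Gamma y - gm).
  rewrite (_ : _ - _ - _ = Gamma x - Gamma y); last by ring.
  have : y <= - T by move: xyd => /ltr_normlP[]; lra.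
  have xT' : x <= - T by lra.
  by move=> /H2; have := H2 _ xT'; lra.
case: (ltP (T + 1) x) => [xT _|xT]; last first.
  by apply; rewrite //= in_itv/= Tx xT.
have := ler_normB (Gamma x - gp) (Gamma y - gp).
rewrite (_ : _ - _ - _ = Gamma x - Gamma y); last by ring.
have : T <= y by move: xyd => /ltr_normlP[]; lra.
have xT' : T <= x by lra.
by move=> /H1; have := H1 _ xT'; lra.
Qed.

End Profile.

(** * The sample-and-hold clock *)

Section HoldTime.
Context {R : realType}.
Implicit Types (h t s : R).

(** The last sampling instant before [t], with continuous time at
    [h = 0]; transition functions at finite speed are the profile evaluated
    along it. *)
Definition hold_time h t : R :=
  if h == 0 then t else (Num.floor (t / h))%:~R * h.

Lemma hold_time_bounds h t : 0 <= h -> t - h <= hold_time h t <= t.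
Proof.
rewrite le_eqVlt eq_sym /hold_time => /predU1P[->|h0].
  by rewrite eqxx subr0 lexx.
rewrite gt_eqF//.
have fl := floor_le (t / h); have lf := floorD1_gt (t / h).
rewrite ler_pdivlMr// in fl; rewrite ltr_pdivrMr// intrD mulrDl mul1r in lf.
by rewrite fl andbT; lra.
Qed.

Lemma hold_time_eq h t (z : int) : z%:~R * h <= t < (z + 1)%:~R * h ->
  hold_time h t = z%:~R * h.
Proof.
move=> /andP[zt tz]; have h0 : 0 < h.
  by have := le_lt_trans zt tz; rewrite intrD mulrDl mul1r; lra.
rewrite /hold_time gt_eqF// (@floor_def _ _ z)//.
by rewrite ler_pdivlMr// zt ltr_pdivrMr.
Qed.

Lemma measurable_hold_time h : 0 <= h -> measurable_fun setT (hold_time h).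
Proof.
move=> h0; apply: nondecreasing_measurable => // s t st.
rewrite /hold_time; case: eqP => // /eqP nh.
by rewrite ler_wpM2r// ler_int le_floor// ler_wpM2r ?invr_ge0.
Qed.

(** Away from the sampling instants of the limit the floor is eventually
    constant.  The second conclusion records that a limit equal to 0 is
    reached exactly, which is needed where the speed is infinite. *)
Lemma hold_time_cvg (h_ : nat -> R) h t : (forall n, 0 <= h_ n) -> 0 <= h ->
  h_ n @[n --> \oo] --> h -> (forall z : int, t != z%:~R * h) ->
  hold_time (h_ n) t @[n --> \oo] --> hold_time h t /\
  (hold_time h t = 0 -> \forall n \near \oo, hold_time (h_ n) t = 0).
Proof.
move=> h_0 h0 hh nt; move: h0; rewrite le_eqVlt eq_sym => /predU1P[h0|h0].
  have hE : hold_time h t = t by rewrite /hold_time h0 eqxx.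
  rewrite hE; split; last by move=> t0; have := nt 0; rewrite t0 mul0r eqxx.
  apply: (@squeeze_cvgr _ _ _ _ (fun n => t - h_ n) (fun=> t)).
  - by apply: nearW => n; exact: hold_time_bounds.
  - rewrite -[X in _ --> X]subr0 -h0; apply: cvgB => //; exact: cvg_cst.
  - exact: cvg_cst.
pose z := Num.floor (t / h).
have hE : hold_time h t = z%:~R * h by rewrite /hold_time gt_eqF.
have zt : z%:~R * h < t.
  by rewrite lt_neqAle eq_sym nt -ler_pdivlMr// floor_le.
have tz : t < (z + 1)%:~R * h by rewrite -ltr_pdivrMr// floorD1_gt.
have near_eq : \forall n \near \oo, hold_time (h_ n) t = z%:~R * h_ n.
  have c1 : z%:~R * h_ n @[n --> \oo] --> z%:~R * h by apply: cvgMr.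
  have c2 : (z + 1)%:~R * h_ n @[n --> \oo] --> (z + 1)%:~R * h by apply: cvgMr.
  near=> n; apply: hold_time_eq; apply/andP; split; first apply: ltW.
    by near: n; apply: (cvgr_lt _ c1).
  by near: n; apply: (cvgr_gt _ c2).
rewrite hE; split.
  apply: (@cvg_trans _ (z%:~R * h_ n @[n --> \oo])); last exact: cvgMr.
  by apply: near_eq_cvg; apply: filterS near_eq => n ->.
move=> /eqP; rewrite mulf_eq0 (gt_eqF h0) orbF => /eqP z0.
by apply: filterS near_eq => n ->; rewrite z0 mul0r.
Unshelve. all: by end_near. Qed.

End HoldTime.

(** * Transition functions *)

Section Transition.
Context {R : realType}.
Notation mu := (@lebesgue_measure R).
Variables (Gamma : R -> R) (gm gp : R).
Hypotheses (Gamma_cont : continuous Gamma)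
  (Gamma_ninfty : Gamma t @[t --> -oo] --> gm)
  (Gamma_pinfty : Gamma t @[t --> +oo] --> gp).
Implicit Types (h s t T e : R) (c : \bar R).
Local Notation trans := (transition Gamma gm gp).

Definition extended_profile c : R :=
  match c with EFin r => Gamma r | +oo%E => gp | -oo%E => gm end.

Lemma transition_fin (r : R) h t : trans r%:E h t = Gamma (r * hold_time h t).
Proof. by rewrite /transition /hold_time; case: eqP => //= _; rewrite mulrA. Qed.

(** One formula covers finite and infinite speeds: the convention that
    infinity times 0 is 0 reproduces the value [Gamma 0] on [0, h[.  The time
    0 is excluded because at h = 0 and infinite speed the product would give
    [Gamma 0] there. *)
Lemma transitionE c h t : 0 <= h -> t != 0 ->
  trans c h t = extended_profile (c * (hold_time h t)%:E).
Proof.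
move=> h0 t0.
have sgn : (t < 0 /\ hold_time h t < 0) \/
    (0 <= t /\ (h <= t /\ 0 < hold_time h t \/ t < h /\ h != 0 /\ hold_time h t = 0)).
  have /andP[_ ht] := hold_time_bounds t h0.
  have [tn|tp] := ltP t 0; first by left; split=> //; exact: le_lt_trans ht tn.
  right; split=> //; have [t_h|h_t] := ltP t h.
    right; split=> //; split; first by rewrite gt_eqF// (le_lt_trans tp).
    by rewrite (@hold_time_eq _ _ _ 0) mul0r// tp add0r mul1r.
  left; split=> //; rewrite /hold_time; case: eqP => [_|/eqP nh].
    by rewrite lt_neqAle eq_sym t0.
  have hp : 0 < h by rewrite lt_neqAle eq_sym nh.
  by rewrite mulr_gt0// ltr0z floor_gt0 ler_pdivlMr// mul1r.
case: c => [r||]; first by rewrite transition_fin.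
- case: sgn => [[tn hn]|[tp [[h_t hp]|[t_h [nh hz]]]]].
  + by rewrite lt0_mulye// /transition; case: eqP => _ /=; rewrite tn.
  + rewrite gt0_mulye// /transition; case: eqP => _ /=; rewrite ltNge tp//=.
    by rewrite ltNge h_t.
  + by rewrite hz mule0 /transition (negPf nh)/= ltNge tp/= t_h.
- case: sgn => [[tn hn]|[tp [[h_t hp]|[t_h [nh hz]]]]].
  + by rewrite lt0_mulNye// /transition; case: eqP => _ /=; rewrite tn.
  + rewrite gt0_mulNye// /transition; case: eqP => _ /=; rewrite ltNge tp//=.
    by rewrite ltNge h_t.
  + by rewrite hz mule0 /transition (negPf nh)/= ltNge tp/= t_h.
Qed.

Lemma extended_profile_continuous : continuous extended_profile.
Proof.
move=> [r||] A /=.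
- by move/(Gamma_cont (x := r)).
- move=> nA; have [M [Mr HM]] := Gamma_pinfty nA; exists M; split=> // -[s||] //=.
    by rewrite lte_fin; exact: HM.
  by move=> _; exact: nbhs_singleton.
- move=> nA; have [M [Mr HM]] := Gamma_ninfty nA; exists M; split=> // -[s||] //=.
    by rewrite lte_fin; exact: HM.
  by move=> _; exact: nbhs_singleton.
Qed.

Lemma transition_bounded_measurable c h : 0 <= h ->
  bounded_measurable (supnorm Gamma) (trans c h).
Proof.
move=> h0; have [gmS gpS] := profile_limit_supnorm Gamma_cont Gamma_ninfty Gamma_pinfty.
have GS := profile_supnorm Gamma_cont Gamma_ninfty Gamma_pinfty.
have mlt (a : R) : measurable_fun setT (fun t => t < a).
  by apply: measurable_fun_ltr.
split.
  case: c => [r||].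
  - rewrite (_ : trans _ _ = Gamma \o (fun t => r * hold_time h t)); last first.
      by apply/funext => t; rewrite transition_fin.
    apply: measurableT_comp; first exact: continuous_measurable_fun.
    by apply: measurable_funM => //; exact: measurable_hold_time.
  - rewrite /transition; case: eqP => _; apply: measurable_fun_ifT => //.
    exact: measurable_fun_ifT.
  - rewrite /transition; case: eqP => _; apply: measurable_fun_ifT => //.
    exact: measurable_fun_ifT.
move=> t; rewrite /transition; case: eqP => _; case: c => [r||] //=.
- by case: ifP.
- by case: ifP.
- by case: ifP => // _; case: ifP.
- by case: ifP => // _; case: ifP.
Qed.

End Transition.

(** * Limits of transition functions *)

Section TransitionLimits.
Context {R : realType}.
Notation mu := (@lebesgue_measure R).
Implicit Types (Gamma p : R -> R) (gm gp h s t T e : R) (c : \bar R).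

(** Reduces negative speeds to positive ones. *)
Lemma transition_opp Gamma gm gp c h :
  transition (Gamma \o -%R) gp gm (- c)%E h = transition Gamma gm gp c h.
Proof.
apply/funext => t; rewrite /transition; case: eqP => _; case: c => [r||] //=.
- by rewrite mulNr opprK.
- by rewrite !mulNr opprK.
- by rewrite oppr0.
- by rewrite oppr0.
Qed.

Lemma nbhs_ereal_gt0 c : (0 < c)%E -> exists2 a : R, 0 < a &
  (a%:E <= c)%E /\ nbhs c [set x | (a%:E <= x)%E].
Proof.
case: c => [r||] //; last first.
  by move=> _; exists 1 => //; split; [exact: leey|exists 1; split=> // x /ltW].
rewrite lte_fin => r0; have r20 : 0 < r / 2 by rewrite divr_gt0.
exists (r / 2) => //; split; first by rewrite lee_fin; lra.
have rr : r / 2 < r by lra.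
have := lt_nbhsr rr; rewrite /nbhs /=.
by apply: filterS => x /ltW; rewrite /= lee_fin.
Qed.

Section limits.
Variables (Gamma : R -> R) (gm gp : R).
Hypotheses (Gamma_cont : continuous Gamma)
  (Gamma_ninfty : Gamma t @[t --> -oo] --> gm)
  (Gamma_pinfty : Gamma t @[t --> +oo] --> gp).
Local Notation trans := (transition Gamma gm gp).

(** The threshold is uniform over speeds at least [a] and steps at most
    [H]: beyond T0 / a + H the held time exceeds T0 / a. *)
Lemma transition_tails (a H e : R) : 0 < a -> 0 <= H -> 0 < e ->
  exists T, forall c h, (a%:E <= c)%E -> 0 <= h <= H ->
  (forall t, T < t -> `|trans c h t - gp| <= e) /\
  (forall t, t < - T -> `|trans c h t - gm| <= e).
Proof.
move=> a0 H0 e0.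
have [T0 T00 [T1 T2]] := profile_tails Gamma_ninfty Gamma_pinfty e0.
have Ta0 : 0 < T0 / a by rewrite divr_gt0.
exists (T0 / a + H) => c h ac /andP[h0 hH].
case: c ac => [r||] //; last first.
  move=> _; split=> t Tt; rewrite /transition.
    have t0 : 0 <= t by lra.
    have ht : h <= t by lra.
    by case: eqP => _ /=; rewrite ltNge t0/= ?(ltNge t) ?ht /= subrr normr0 ltW.
  have t0 : t < 0 by lra.
  by case: eqP => _ /=; rewrite t0 subrr normr0 ltW.
rewrite lee_fin => ar; have r0 : 0 < r := lt_le_trans a0 ar.
have TE : T0 = a * (T0 / a) by rewrite mulrCA divff ?mulr1// gt_eqF.
split=> t Tt; rewrite transition_fin; have /andP[lt tl] := hold_time_bounds t h0.
  apply: T1; rewrite TE; apply: ler_pM => //; [exact: ltW|exact: ltW|lra].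
apply: T2; rewrite TE lerNr -mulrN; apply: ler_pM => //; [exact: ltW|exact: ltW|lra].
Qed.

Section sequences.
Variables (c_ : nat -> \bar R) (h_ : nat -> R) (c : \bar R) (h : R).
Hypotheses (h_ge0 : forall n, 0 <= h_ n) (h0 : 0 <= h).
Hypotheses (c_cvg : c_ n @[n --> \oo] --> c) (h_cvg : h_ n @[n --> \oo] --> h).

(** Continuity of the extended product fails only at infinity times 0; there
    the held times are eventually exactly 0. *)
Lemma transition_cvg t : (forall z : int, t != z%:~R * h) ->
  trans (c_ n) (h_ n) t @[n --> \oo] --> trans c h t.
Proof.
move=> nt; have t0 : t != 0 by have := nt 0; rewrite mul0r.
rewrite transitionE//.
under eq_fun do rewrite transitionE//.
apply: (@cvg_comp _ _ _ (fun n => c_ n * (hold_time (h_ n) t)%:E)%E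
  (extended_profile Gamma gm gp)); last first.
  exact: (extended_profile_continuous Gamma_cont Gamma_ninfty Gamma_pinfty).
have [holdc hold0] := hold_time_cvg h_ge0 h0 h_cvg nt.
have [/[dup] hz /hold0 near0|nz] := eqVneq (hold_time h t) 0.
  rewrite hz mule0; apply: cvg_near_cst.
  by apply: filterS near0 => n /= ->; rewrite mule0.
apply: cvgeM => //.
  by rewrite mule_defE /= eqe (negPf nz) /= andbF.
by apply: cvg_EFin; [exact: nearW|exact: holdc].
Qed.

(** Pointwise convergence fails at most on the countable set of sampling
    instants. *)
Lemma transition_integral_cvg T e : 0 < e -> \forall n \near \oo,
  \int[mu]_(s in `[- T, T]) `|trans (c_ n) (h_ n) s - trans c h s| <= e.
Proof.
move=> e0; pose S := supnorm Gamma.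
have bt c' h' : 0 <= h' -> bounded_measurable S (trans c' h').
  exact: transition_bounded_measurable.
pose f_ n : R -> \bar R := EFin \o trans (c_ n) (h_ n).
have := @dominated_convergence _ _ _ mu `[- T, T]%classic (measurable_itv _) f_
  (EFin \o trans c h) (cst S%:E).
case.
- move=> n; apply/measurable_EFinP; apply: measurable_funTS.
  exact: (bt _ _ (h_ge0 n)).1.
- by apply/measurable_EFinP; apply: measurable_funTS; exact: (bt _ _ h0).1.
- have cZ : countable (range (fun z : int => z%:~R * h)).
    by apply: sub_countable (card_image_le _ _) _; exact: countableP.
  exists (range (fun z : int => z%:~R * h)); split.
  - exact: countable_measurable.
  - exact: countable_lebesgue_measure0.
  - move=> t /= /not_implyP[_ nt]; apply: contrapT => nr; apply: nt.
    apply: cvg_EFin; first exact: nearW.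
    apply: transition_cvg => z; apply/eqP => tz; apply: nr.
    by exists z.
- apply: (@measurable_bounded_integrable _ _ _ mu (cst S)) => //.
    rewrite [X in (X < _)%E](lebesgue_measure_itv `[- T, T]) /=.
    by case: ifP => _; rewrite ?ltry// -EFinB ltry.
  exists `|S|; split; first exact: num_real.
  by move=> M SM t _ /=; exact: ltW.
- apply: aeW => t n _; rewrite /= lee_fin; exact: (bt _ _ (h_ge0 n)).2.
move=> _ + _ => /fine_cvgP[_]/cvgrPdist_le/(_ e e0); apply: filterS => n.
rewrite sub0r normrN => /(le_trans (ler_norm _)).
by rewrite /Rintegral /=.
Qed.

Lemma transition_tails_cvg e : (0 < c)%E -> 0 < e ->
  exists T, \forall n \near \oo, forall t, T < `|t| ->
    `|trans (c_ n) (h_ n) t - trans c h t| <= e.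
Proof.
move=> c0 e0; have [a a0 [ac near_a]] := nbhs_ereal_gt0 c0.
have H0 : 0 <= h + 1 by rewrite addr_ge0.
have e20 : 0 < e / 2 by rewrite divr_gt0.
have [T HT] := transition_tails a0 H0 e20; exists T.
have near_h : \forall n \near \oo, h_ n <= h + 1.
  by apply: (cvgr_le _ h_cvg); rewrite ltrDl.
have near_c : \forall n \near \oo, (a%:E <= c_ n)%E by exact: c_cvg near_a.
have hh : 0 <= h <= h + 1 by rewrite h0 lerDl ler01.
have [t3 t4] := HT _ _ ac hh.
have tri (x y z : R) : `|x - z| <= e / 2 -> `|y - z| <= e / 2 -> `|x - y| <= e.
  move=> xz yz; have := ler_normB (x - z) (y - z).
  by rewrite (_ : _ - _ - _ = x - y); [lra|ring].
apply: filterS2 near_c near_h => n acn hn t.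
have hnh : 0 <= h_ n <= h + 1 by rewrite h_ge0.
have [t1 t2] := HT _ _ acn hnh.
rewrite ltr_normr => /orP[Tt|Tt].
  exact: tri (t1 _ Tt) (t3 _ Tt).
have {}Tt : t < - T by lra.
exact: tri (t2 _ Tt) (t4 _ Tt).
Qed.

End sequences.
End limits.
End TransitionLimits.

(** * Continuity of the bifurcation value *)

Section SequentialContinuity.
Context {R : realType}.
Variables (p : R -> R) (P : R).
Hypotheses (pP : bounded_measurable P p).
Implicit Types (Gamma : R -> R) (gm gp e : R).

(** Balls of radius 1 / (n + 1) form a countable base, so sequences detect
    continuity; this is what makes dominated convergence applicable. *)
Lemma sequential_continuity_within (X : pseudoMetricType R) (A : set X) (F : X -> R) :
  (forall x (x_ : nat -> X), A x -> (forall n, A (x_ n)) -> x_ n @[n --> \oo] --> x ->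
     forall e, 0 < e -> \forall n \near \oo, `|F x - F (x_ n)| <= e) ->
  {within A, continuous F}.
Proof.
move=> H; apply/subspace_continuousP => x Ax; apply/cvgrPdist_le => e e0.
apply: contrapT => nH.
have /choice[x_ xP] (n : nat) : exists y, [/\ ball x n.+1%:R^-1 y, A y &
    ~ `|F x - F y| <= e].
  apply: contrapT => nE; apply: nH; rewrite near_withinE.
  apply/nbhs_ballP; exists n.+1%:R^-1 => //= y xy Ay.
  by apply: contrapT => nFy; apply: nE; exists y.
have xx : x_ n @[n --> \oo] --> x.
  apply/cvg_ballP => d d0; near=> n.
  have [bxn _ _] := xP n; apply: le_ball bxn; apply: ltW.
  near: n; exact: (near_infty_natSinv_lt (PosNum d0)).
have [N _ HN] := H x x_ Ax (fun n => let: And3 _ a _ := xP n in a) xx e e0.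
by have [_ _] := xP N; apply; exact: (HN N (leqnn N)).
Unshelve. all: by end_near. Qed.

Section sequences.
Variables (h_ : nat -> R) (h : R).
Hypotheses (h_ge0 : forall n, 0 <= h_ n) (h0 : 0 <= h).
Hypotheses (h_cvg : h_ n @[n --> \oo] --> h).

Lemma bifurcation_transition_pos (c_ : nat -> \bar R) Gamma gm gp c e : continuous Gamma ->
  Gamma t @[t --> -oo] --> gm -> Gamma t @[t --> +oo] --> gp ->
  c_ n @[n --> \oo] --> c -> (0 < c)%E -> 0 < e ->
  \forall n \near \oo, `|bifurcation_value (transition Gamma gm gp c h) p -
    bifurcation_value (transition Gamma gm gp (c_ n) (h_ n)) p| <= e.
Proof.
move=> Gc Gm Gp cc c0 e0; pose G := supnorm Gamma.
have G0 : 0 <= G := le_trans (normr_ge0 _) (profile_supnorm Gc Gm Gp 0).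
have [eta eta0 close] := bifurcation_value_integral_close G0 pP e0.
have [T nearT] := transition_tails_cvg Gm Gp h_ge0 h0 cc h_cvg c0 eta0.
have nearI := transition_integral_cvg Gc Gm Gp h_ge0 h0 cc h_cvg T eta0.
apply: filterS2 nearT nearI => n out int_le; rewrite distrC.
by apply: (close _ _ _ _ T) => //; exact: transition_bounded_measurable.
Qed.

Lemma bifurcation_transition_neg (c_ : nat -> \bar R) Gamma gm gp c e : continuous Gamma ->
  Gamma t @[t --> -oo] --> gm -> Gamma t @[t --> +oo] --> gp ->
  c_ n @[n --> \oo] --> c -> (c < 0)%E -> 0 < e ->
  \forall n \near \oo, `|bifurcation_value (transition Gamma gm gp c h) p -
    bifurcation_value (transition Gamma gm gp (c_ n) (h_ n)) p| <= e.
Proof.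
move=> Gc Gm Gp cc c0 e0.
have GcN : continuous (Gamma \o -%R).
  by move=> t; apply: continuous_comp; [exact: oppr_continuous|exact: Gc].
have GmN : (Gamma \o -%R) t @[t --> -oo] --> gp by apply/cvgy_compNP.
have GpN : (Gamma \o -%R) t @[t --> +oo] --> gm by apply/cvgNy_compNP.
have ccN : (- c_ n)%E @[n --> \oo] --> (- c)%E by exact: cvgeN.
have cN0 : (0 < - c)%E by rewrite oppe_gt0.
have := bifurcation_transition_pos GcN GmN GpN ccN cN0 e0.
by apply: filterS => n; rewrite !transition_opp.
Qed.

(** The limit function is the constant [Gamma 0], and a small speed makes
    the difference slow: over a time t - s it changes by at most
    eta / 4 + b |r| (t - s + h + 1). *)
Lemma bifurcation_transition_zero (c_ : nat -> \bar R) Gamma gm gp e : continuous Gamma ->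
  Gamma t @[t --> -oo] --> gm -> Gamma t @[t --> +oo] --> gp ->
  c_ n @[n --> \oo] --> 0%:E -> 0 < e ->
  \forall n \near \oo, `|bifurcation_value (transition Gamma gm gp 0%:E h) p -
    bifurcation_value (transition Gamma gm gp (c_ n) (h_ n)) p| <= e.
Proof.
move=> Gc Gm Gp cc e0; pose G := supnorm Gamma.
have G0 : 0 <= G := le_trans (normr_ge0 _) (profile_supnorm Gc Gm Gp 0).
have [eta eta0 close] := bifurcation_value_slow_close G0 pP e0.
have eta40 : 0 < eta / 4 by rewrite divr_gt0.
have [b b0 unif] := profile_uniform_continuity Gc Gm Gp eta40.
have bh0 : 0 < b * (h + 3) + 1 by rewrite ltr_wpDl// mulr_ge0// addr_ge0.
pose d := eta / 4 / (b * (h + 3) + 1).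
have d0 : 0 < d by rewrite divr_gt0.
have near_h : \forall n \near \oo, h_ n <= h + 1.
  by apply: (cvgr_le _ h_cvg); rewrite ltrDl.
have near_c : \forall n \near \oo, exists2 r, c_ n = r%:E & `|r| < d.
  have n0 : nbhs (0%:E : \bar R) [set x | exists2 r, x = r%:E & `|r| < d].
    have := nbhsx_ballx (0 : R) d d0; rewrite /nbhs/=.
    by apply: filterS => r; rewrite /ball/= sub0r normrN => rd; exists r.
  exact: cc n0.
apply: filterS2 near_c near_h => n [r -> rd] hn.
rewrite distrC.
have r0 := normr_ge0 r.
apply: (close _ _ _ _ (eta / 4 + b * `|r| * (h + 1)) (b * `|r|)).
- exact: transition_bounded_measurable.
- exact: transition_bounded_measurable.
- by rewrite addr_ge0 ?(ltW eta40)// !mulr_ge0// addr_ge0.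
- by rewrite mulr_ge0.
- move=> s t st; rewrite !transition_fin !mul0r.
  rewrite (_ : _ - _ - _ = Gamma (r * hold_time (h_ n) s) -
    Gamma (r * hold_time (h_ n) t)); last by ring.
  rewrite (le_trans (unif _ _))// -addrA lerD2l -mulrDr -mulrBr normrM -!mulrA.
  rewrite ler_wpM2l// ler_wpM2l//.
  have /andP[s1 s2] := hold_time_bounds s (h_ge0 n).
  have /andP[t1 t2] := hold_time_bounds t (h_ge0 n).
  by have := h_ge0 n; rewrite ler_norml => ?; apply/andP; split; lra.
- have : b * `|r| * (h + 3) <= eta / 4.
    apply: (@le_trans _ _ (d * (b * (h + 3) + 1))); last first.
      by rewrite /d divfK// gt_eqF.
    rewrite mulrAC mulrC; apply: ler_pM => //; [|exact: ltW|lra].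
    by rewrite mulr_ge0// addr_ge0.
  by lra.
Qed.

End sequences.
End SequentialContinuity.

Unset Implicit Arguments.
Set Strict Implicit.

Theorem theorem5p3 (R : realType) (Gamma p : R -> R) (gm gp : R)
    (Gamma_cont : continuous Gamma)
    (Gamma_ninfty : Gamma t @[t --> -oo] --> gm)
    (Gamma_pinfty : Gamma t @[t --> +oo] --> gp)
    (p_BPUC : BPUC p) :
  (forall (c : \bar R) (h : R), 0 <= h ->
     - supnorm p <= lambda_transition Gamma gm gp p c h
                 <= supnorm p + supnorm Gamma ^+ 2) /\
  {within [set ch : \bar R * R | 0 <= ch.2],
     continuous (fun ch : \bar R * R =>
       lambda_transition Gamma gm gp p ch.1 ch.2)}.
Proof.
have pP := BPUC_bounded_measurable p_BPUC.
split=> [c h h0|].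
  apply: bifurcation_value_bounds => //.
  exact: transition_bounded_measurable.
apply: sequential_continuity_within => -[c h] x_ /= h0 x_ge0 xx e e0.
have cc : (x_ n).1 @[n --> \oo] --> c by apply: (cvg_comp _ _ xx); exact: cvg_fst.
have hh : (x_ n).2 @[n --> \oo] --> h by apply: (cvg_comp _ _ xx); exact: cvg_snd.
have [c0|c0|c0] := ltgtP 0%E c.
- exact: (bifurcation_transition_pos pP x_ge0 h0 hh).
- exact: (bifurcation_transition_neg pP x_ge0 h0 hh).
- by rewrite -c0 in cc *; exact: (bifurcation_transition_zero pP x_ge0 h0 hh).
Qed.
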